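(* Let $H=\{(s,t)\in[0,1]^2:s\le t\}$ and let $T:H\to[0,+\infty)$ satisfy $$T(r,s)\le T(r,t)-T(s,t)\qquad\text{for all }0\le r\le s\le t\le1 .$$ Extend $T$ to $\{(s,t)\in\mathbb R^2:s\le t\}$ by $T(s,t):=T\big(\min\{\max\{s,0\},1\},\min\{\max\{t,0\},1\}\big)$. Then: (i) There exists a unique maximal element $\mu$ among all (non-negative) Borel measures $\nu$ on $\mathbb R$ which satisfy $\nu((a,b))\le T(a,b)$ for all $a<b$ in $\mathbb R$. (ii) The measure $\mu$ is the weak limit (in duality with $C_c(\mathbb R)$) as $h\downarrow0$ of the measures $\mu_h$ given by $\mathrm d\mu_h(t)=\frac{T(t,t+h)}h\,\mathrm d\mathscr L^1(t)$. Moreover, writing $\mu=\rho\mathscr L^1+\mu^\perp$ for the Lebesgue decomposition of $\mu$, for $\mathscr L^1$-a.e. $t\in\mathbb R$ we have $$\rho(t)=\lim_{n\to\infty}\frac{T(r_n,s_n)}{s_n-r_n}$$ for all sequences $(r_n),(s_n)\subset[0,1]$ with $r_n\uparrow t$, $s_n\downarrow t$ and $r_n<s_n$ for every $n$. (iii) For every $0\ne q<1$ and every partition $P=\{0=t_0<t_1<\dots<t_n=1\}$ of $[0,1]$ define $$A_q(P):=\sum_{i=0}^{n-1}(t_{i+1}-t_i)\,u_q\Big(\frac{T(t_i,t_{i+1})}{t_{i+1}-t_i}\Big).$$ If $P$ is finer than $Q$, then $A_q(P)\le A_q(Q)$; and $$\int_0^1u_q(\rho)\,\mathrm d\mathscr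 L^1=\inf_PA_q(P),$$ the infimum being over all partitions of $[0,1]$. (iv) For a partition $P=\{0=t_0<t_1<\dots<t_n=1\}$ of $[0,1]$ put $|P|:=\max_i|t_{i+1}-t_i|$. Then for every $0\ne q<1$ and any sequence $(P_k)$ of partitions of $[0,1]$ with $|P_k|\to0$, $$\int_0^1u_q(\rho)\,\mathrm d\mathscr L^1=\lim_{k\to\infty}A_q(P_k).$$
   Context: $\mathscr L^1$ is Lebesgue measure on $\mathbb R$. For $0\ne q<1$, $u_q(z)=z^q/q$ for $z\in(0,\infty)$, $u_q(0)=-\infty$ if $q<0$ and $u_q(0)=0$ if $q\in(0,1)$. ''Maximal'' in (i) means largest with respect to the order $\nu\le\mu$ meaning $\nu(B)\le\mu(B)$ for all Borel $B$. *)

(* Defs.v *)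
From HB Require Import structures.
From mathcomp Require Import all_boot all_order all_algebra.
From mathcomp Require Import all_classical all_reals all_analysis.
Set Implicit Arguments.
Unset Strict Implicit.
Unset Printing Implicit Defensive.
Import Order.TTheory GRing.Theory Num.Theory.
Import numFieldNormedType.Exports.
Local Open Scope classical_set_scope.
Local Open Scope ring_scope.

(* [measurableTypeR R] is R with its Borel sigma-algebra (generated by the
   intervals ]a, b]). A library measure is a function on all sets constrained
   only on measurable ones, so measures are compared on Borel sets. *)
Notation borel_measure R :=
  {measure set (measurableTypeR R%type) -> \bar R%type}.

(* A function T on H = {(s,t) in [0,1]^2 | s <= t} is given as a total function
   of which only the values on H matter; [extend T] uses no other value. *)
Definition clamp01 (R : realType) (x : R) : R := Num.min (Num.max x 0) 1.

Definition extend (R : realType) (T : R -> R -> R) (s t : R) : R :=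
  T (clamp01 s) (clamp01 t).

Definition admissible (R : realType) (T : R -> R -> R) (nu : borel_measure R) :=
  forall a b : R, a < b -> (nu `]a, b[%classic <= (extend T a b)%:E)%E.

Definition maximal_admissible (R : realType) (T : R -> R -> R)
    (mu : borel_measure R) :=
  admissible T mu /\
  forall nu : borel_measure R, admissible T nu ->
    forall B : set (measurableTypeR R), measurable B -> (nu B <= mu B)%E.

Definition compactly_supported_continuous (R : realType) (f : R -> R) :=
  continuous f /\ compact (closure [set x | f x != 0]).

(* For h > 0, [m] is the measure with density t |-> T(t, t + h) / h with respect
   to Lebesgue measure. This density can fail to be Borel measurable for some
   h; the library integral of a nonnegative function is the supremum of the
   integrals of the nonnegative Borel simple functions below it, which is
   countably additive in the domain of integration in every case, and is the
   usual integral as soon as the density is Lebesgue measurable. *)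
Definition is_mu_h (R : realType) (T : R -> R -> R) (h : R)
    (m : borel_measure R) :=
  forall B : set (measurableTypeR R), measurable B ->
    m B = (\int[lebesgue_measure]_(t in B) (extend T t (t + h) / h)%:E)%E.

Definition mutually_singular (R : realType) (m1 m2 : borel_measure R) :=
  exists N : set (measurableTypeR R),
    [/\ measurable N, m1 N = 0%E & m2 (~` N) = 0%E].

Definition lebesgue_decomposition (R : realType) (mu : borel_measure R)
    (rho : R -> R) (mus : borel_measure R) :=
  [/\ measurable_fun [set: measurableTypeR R] (rho : measurableTypeR R -> R),
      forall t : R, 0 <= rho t,
      mutually_singular lebesgue_measure mus &
      forall B : set (measurableTypeR R), measurable B ->
        mu B = ((\int[lebesgue_measure]_(t in B) (rho t)%:E) + mus B)%E].

(* Meant for 0 <> q < 1 and z >= 0. *)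
Definition u_ (R : realType) (q z : R) : \bar R :=
  if z == 0 then (if q < 0 then -oo%E else 0%E) else (z `^ q / q)%:E.

(* As for [itv_partition 0 1], a partition 0 = t_0 < t_1 < ... < t_n = 1 is
   encoded by the sequence P = [:: t_1; ...; t_n], without t_0. *)
Definition pt (R : realType) (P : seq R) (i : nat) : R := nth 0 (0 :: P) i.

Definition A_ (R : realType) (T : R -> R -> R) (q : R) (P : seq R) : \bar R :=
  (\sum_(i < size P) (pt P i.+1 - pt P i)%:E *
     u_ q (T (pt P i) (pt P i.+1) / (pt P i.+1 - pt P i)))%E.

Definition mesh (R : realType) (P : seq R) : R :=
  \big[Num.max/0]_(i < size P) `|pt P i.+1 - pt P i|.

(* Main.v *)
(* mu is the Caratheodory outer measure generated by open intervals ]a, b[ of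
   cost T(a, b): by countable subadditivity it dominates every admissible
   measure, it is admissible by construction, and superadditivity of T is what
   makes Borel sets measurable for it.

   Since mu is an infimum over covers, the complement of a Lebesgue-null set
   carrying the singular part has covers on which the superadditive function
   E(a, b) = T(a, b) - int_a^b rho >= 0 sums to arbitrarily little. A Vitali
   covering argument bounds the measure of {t | E(r, s) > c (s - r) for some
   r <= t <= s} by 5 E(a, b) / c on each interval of the cover, so T(r, s) / (s - r)
   tends to rho(t) for a.e. t as ]r, s[ shrinks to t.

   For the weak limit, T(t, t + h) >= mu(]t, t + h[) and Tonelli bound int f dmu_h
   from below for f >= 0, so that only the total masses have to be bounded from
   above; for these, T(t, t + h) <= T(a, t + h) - T(a, t) is integrated over the
   intervals ]a, b - h[ of an almost optimal cover.

   For the utilities, the tangent inequality u(z) <= u(z0) + u'(z0) (z - z0)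
   yields both A_q(P) <= A_q(Q) for P finer than Q and int u(rho) <= A_q(P). Seeing
   A_q(P) as the integral of u at a step function that converges to rho a.e.,
   Fatou's lemma applied to e z + C - u(z) >= 0 gives the converse in the limit. *)
Require Import Defs.
From HB Require Import structures.
From mathcomp Require Import all_boot all_order all_algebra.
From mathcomp Require Import all_classical all_reals all_analysis measurable_realfun.
From mathcomp Require Import ring lra.
Import Order.TTheory GRing.Theory Num.Theory.
Import numFieldNormedType.Exports.
Local Open Scope classical_set_scope.
Local Open Scope ring_scope.
Set Implicit Arguments.
Unset Strict Implicit.
Unset Printing Implicit Defensive.

(** * The maximal measure *)

(** The properties of the extended T on which the measure and utility arguments rest, M standing for
    T(0, 1). They are stated on the whole line, so that these arguments involve no clamping. *)
Record interval_mass (R : realType) (W : R -> R -> R) (M : R) : Prop := {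
  im_ge0 : forall s t, s <= t -> 0 <= W s t;
  im_super : forall r s t, r <= s -> s <= t -> W r s + W s t <= W r t;
  im_le : forall s t, s <= t -> W s t <= M;
  im_supp : forall s t, s <= t -> t <= 0 \/ 1 <= s -> W s t = 0 }.

Lemma im_mono (R : realType) (W : R -> R -> R) (M : R) :
  interval_mass W M ->
  forall a r s b, a <= r -> r <= s -> s <= b -> W r s <= W a b.
Proof.
move=> HW a r s b ar rs sb.
have h1 := im_super HW ar rs.
have as_ := le_trans ar rs.
have h2 := im_super HW as_ sb.
have h3 := im_ge0 HW ar; have h4 := im_ge0 HW sb.
lra.
Qed.

(** Clamping is monotone with values in [0, 1], so the inequalities are inherited from T. An
    interval off ]0, 1[ is clamped to a single point, and 0 <= T(x, x) <= T(x, x) - T(x, x) forces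
    T(x, x) = 0. *)
Lemma extend_interval_mass (R : realType) (T : R -> R -> R) :
  (forall s t : R, 0 <= s -> s <= t -> t <= 1 -> 0 <= T s t) ->
  (forall r s t : R, 0 <= r -> r <= s -> s <= t -> t <= 1 ->
     T r s <= T r t - T s t) ->
  interval_mass (extend T) (T 0 1).
Proof.
move=> T0 TT.
have c0 (x : R) : 0 <= clamp01 x <= 1.
  by rewrite /clamp01 le_min ge_min le_max !lexx ler01 /= !orbT.
have cm (x y : R) : x <= y -> clamp01 x <= clamp01 y.
  move=> xy; rewrite /clamp01; apply: le_min2 => //; exact: le_max2.
have Tdiag (x : R) : 0 <= x -> x <= 1 -> T x x = 0.
  move=> x0 x1; have := TT _ _ _ x0 (lexx _) (lexx _) x1; rewrite subrr => h.
  by apply/eqP; rewrite eq_le h T0.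
split.
- by move=> s t st; apply: T0; rewrite ?cm//; case/andP: (c0 s); case/andP: (c0 t).
- move=> r s t rs st; rewrite /extend -lerBrDr; apply: TT; rewrite ?cm//.
    by case/andP: (c0 r).
  by case/andP: (c0 t).
- move=> s t st; rewrite /extend.
  have /andP[s0 s1] := c0 s; have /andP[t0 t1] := c0 t.
  have h1 := TT 0 _ 1 (lexx _) s0 s1 (lexx _).
  have h2 := TT _ _ 1 s0 (cm _ _ st) t1 (lexx _).
  have h3 := T0 _ _ (lexx _) s0 s1; have h4 := T0 _ _ t0 t1 (lexx _).
  lra.
- move=> s t st [t0|s1]; rewrite /extend.
    have -> : clamp01 s = 0.
      by rewrite /clamp01 (max_idPr (le_trans st t0)) (min_idPl ler01).
    have -> : clamp01 t = 0 by rewrite /clamp01 (max_idPr t0) (min_idPl ler01).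
    exact: Tdiag.
  have c1 (x : R) : 1 <= x -> clamp01 x = 1.
    by move=> x1; rewrite /clamp01 (max_idPl _) ?(min_idPr x1)// (le_trans ler01).
  by rewrite !c1 ?(le_trans s1 st)//; exact: Tdiag.
Qed.

Section outer_measure.
Local Open Scope ereal_scope.
Variables (R : realType) (W : R -> R -> R) (M : R).
Hypothesis HW : interval_mass W M.

(** [mu_ext] takes infima over covers by measurable sets. Giving each set the cost of the cheapest
    open interval around it turns these into covers by open intervals; a set inside no bounded
    interval costs +oo. *)
Definition hull (A : set (measurableTypeR R)) : \bar R :=
  ereal_inf [set (W p.1 p.2)%:E | p in
    [set p : R * R | (p.1 < p.2)%R /\ A `<=` `]p.1, p.2[%classic]].

Let hull_ge0 A : 0 <= hull A.
Proof.
apply: le_ereal_inf_tmp => _ [[a b] [/= ab _] <-].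
by rewrite lee_fin (im_ge0 HW)// ltW.
Qed.

Lemma hull_le A a b : (a < b)%R -> A `<=` `]a, b[%classic ->
  hull A <= (W a b)%:E.
Proof. by move=> ab Aab; apply: ereal_inf_lbound; exists (a, b). Qed.

Let hull0 : hull set0 = 0.
Proof.
apply/eqP; rewrite eq_le hull_ge0 andbT.
(* The empty set lies in ]2, 3[, which is to the right of 1 and costs nothing. *)
have h : (2 < 3 :> R)%R by rewrite ltr_nat.
apply: le_trans (hull_le h (@sub0set _ _)) _.
by rewrite (im_supp HW) ?(ltW h)//; right; rewrite ler1n.
Qed.

Definition outer_mass_fun : set R -> \bar R := mu_ext hull.

Definition outer_mass : {outer_measure set R -> \bar R} :=
  HB.pack outer_mass_fun (isOuterMeasure.Build R R outer_mass_fun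
    (mu_ext0 hull0 hull_ge0) (mu_ext_ge0 hull_ge0) (le_mu_ext hull)
    (mu_ext_sigma_subadditive hull_ge0)).

Local Notation om := outer_mass.

Lemma outer_mass_itv a b : (a < b)%R -> om `]a, b[%classic <= (W a b)%:E.
Proof.
move=> ab; rewrite /= /outer_mass_fun.
apply: le_trans (hull_le ab (@subset_refl _ _)).
apply: ereal_inf_lbound.
exists (fun n => if n is 0%N then `]a, b[%classic else set0).
  by split => [[|n]//|t tab]; exists 0%N.
rewrite nneseries_recl//= eseries_cond/= eseries0 ?adde0// => -[|]//= k _ _.
Qed.

(* ]c, x_N[ is covered by the intervals ]x_(n+2), x_n[ with x_n = c + 1/(n+1);
   those with n even, and those with n odd, are disjoint, so that their costs
   form a convergent series, of which the tail bounds the outer measure. *)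
Lemma outer_mass_near0 c (e : R) : (0 < e)%R ->
  exists2 d, (0 < d)%R & om `]c, (c + d)%R[%classic <= e%:E.
Proof.
move=> e0; pose x (n : nat) : R := (c + n.+1%:R^-1)%R.
have xlt m n : (m < n)%N -> (x n < x m)%R.
  by move=> mn; rewrite ltrD2l ltf_pV2 ?posrE ?ltr0n// ltr_nat.
have xle m n : (m <= n)%N -> (x n <= x m)%R.
  rewrite leq_eqVlt => /predU1P[->//|h]; exact/ltW/xlt.
pose u n : \bar R := (W (x n.+2) (x n))%:E.
have u0 n : 0 <= u n by rewrite lee_fin (im_ge0 HW)//; apply: xle; exact: leqW.
(* The two terms on the right are the chains of the two parities. By superadditivity a new interval
   []x n.+2, x n[] is absorbed when [W (x n) (x 0)] becomes [W (x n.+2) (x 0)]; the other chain is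
   unchanged. *)
have psum n : (\sum_(0 <= k < n) W (x k.+2) (x k) <=
    W (x n.+1) (x 0%N) + W (x n) (x 0%N))%R.
  elim: n => [|n ih].
    by rewrite big_nil addr_ge0// (im_ge0 HW)// xle.
  rewrite big_nat_recr//=; have := @im_super _ _ _ HW (x n.+2) (x n) (x 0%N).
  move=> /(_ (xle _ _ (leqW (leqnSn _))) (xle _ _ (leq0n _))); lra.
have uoo : \sum_(0 <= k <oo) u k < +oo.
  apply: (@le_lt_trans _ _ (M + M)%:E); last exact: ltry.
  apply: lime_le; first exact: is_cvg_nneseries.
  apply: nearW => n; rewrite sumEFin lee_fin (le_trans (psum n))// lerD//.
    by rewrite (im_le HW)// xle.
  by rewrite (im_le HW)// xle.
have /fine_cvgP[ufin] := nneseries_tail_cvg uoo (fun k _ => u0 k).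
move=> /cvgrPdist_le/(_ e e0) unear.
near \oo => N.
exists (N.+1%:R^-1)%R; first by rewrite invr_gt0.
apply: (@le_trans _ _ (\sum_(N <= k <oo) u k)); last first.
  rewrite -[leLHS]fineK; last by near: N.
  have : (`|0 - fine (\sum_(N <= k <oo) u k)| <= e)%R by near: N.
  by rewrite sub0r normrN lee_fin; exact/le_trans/ler_norm.
have -> : `]c, (c + N.+1%:R^-1)%R[%classic =
    \bigcup_(n in ~` `I_N) `]x n.+2, x n[%classic.
  apply/seteqP; split => t /=; last first.
    move=> [n /= /negP]; rewrite -leqNgt => Nn.
    rewrite !in_itv/= => /andP[h1 h2].
    rewrite (lt_trans _ h1) ?(lt_le_trans h2)//; first exact: (xle _ _ Nn).
    by rewrite ltrDl invr_gt0.
  rewrite in_itv/= => /andP[ct tN].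
  have exn : exists n, (N <= n)%N && (x n.+2 < t)%R.
    near \oo => n; exists n; apply/andP; split; first by near: n; exact: nbhs_infty_ge.
    rewrite /x -ltrBrDl (@lt_trans _ _ n.+1%:R^-1%R)//.
      by rewrite ltf_pV2 ?posrE ?ltr0n// ltr_nat.
    near: n; have ct0 : (0 < t - c)%R by rewrite subr_gt0.
    exact: (near_infty_natSinv_lt (PosNum ct0)).
  (* For the least n >= N with x_(n+2) < t, either n = N and t < x_N by assumption, or minimality
     gives t <= x_(n+1) < x_n. *)
  case: (ex_minnP exn) => n /andP[Nn xnt] nmin.
  exists n; first by apply/negP; rewrite -leqNgt.
  rewrite /= in_itv/= xnt/=.
  move: Nn; rewrite leq_eqVlt => /predU1P[<-//|Nn].
  case: n => [//|n] in Nn xnt nmin *.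
  apply: le_lt_trans (xlt _ _ (ltnSn n.+1)).
  rewrite leNgt; apply/negP => xt.
  by have := nmin n; rewrite -ltnS Nn xt ltnn => /(_ isT).
apply: le_trans (outer_measure_sigma_subadditive_tail om N _) _.
apply: lee_nneseries => [k _ _|k _]; first exact: outer_measure_ge0.
by apply: outer_mass_itv; exact: xlt.
Unshelve. all: by end_near. Qed.

(** It suffices to split one interval ]a, b[ of a cover. When a <= c < b, ]a, c] is enlarged to ]a,
    c + d'[, and ]c, b[ is covered by ]c + d', b[ and ]c, c + d[. Superadditivity bounds the first
    two costs by W(a, b), and [outer_mass_near0] makes the third contribution small. *)
Lemma outer_mass_ray c :
  caratheodory_measurable om `]-oo, c]%classic.
Proof.
have Hitv a b : (a < b)%R -> om (`]a, b[ `&` `]-oo, c]) +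
    om (`]a, b[ `&` ~` `]-oo, c]) <= (W a b)%:E.
  move=> ab; have [bc|cb] := leP b c.
    rewrite [X in _ + om X](_ : _ = set0).
      rewrite outer_measure0 adde0 (le_trans _ (outer_mass_itv ab))//.
      by apply: le_outer_measure => t [].
    apply/seteqP; split => // t []/=; rewrite !in_itv/= => /andP[_ tb] /negP.
    by rewrite -ltNge => ct; have := lt_trans tb (le_lt_trans bc ct); rewrite ltxx.
  have [ca|ac] := ltP c a.
    rewrite [X in om X + _](_ : _ = set0).
      rewrite outer_measure0 add0e (le_trans _ (outer_mass_itv ab))//.
      by apply: le_outer_measure => t [].
    apply/seteqP; split => // t []/=; rewrite !in_itv/= => /andP[at_ _] tc.
    by have := lt_le_trans (lt_trans ca at_) tc; rewrite ltxx.
  apply/lee_addgt0Pr => e e0.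
  have [d d0 hd] := outer_mass_near0 c e0.
  (* Strictly below d, so that the point c + d' lies in ]c, c +
     d[, and strictly below b - c, so that ]c + d', b[ is a genuine interval. *)
  pose d' : R := (Num.min d (b - c) / 2)%R.
  have m0 : (0 < Num.min d (b - c))%R by rewrite lt_min d0 subr_gt0.
  have d'0 : (0 < d')%R by rewrite divr_gt0.
  have [dd db] : (d' < d)%R /\ (c + d' < b)%R.
    have : (Num.min d (b - c) <= d)%R by rewrite ge_min lexx.
    have : (Num.min d (b - c) <= b - c)%R by rewrite ge_min lexx orbT.
    by rewrite /d'; split; lra.
  apply: (@le_trans _ _ ((W a (c + d')%R)%:E + ((W (c + d')%R b)%:E + e%:E))).
    apply: leeD.
      apply: le_trans (outer_mass_itv _); last by rewrite (le_lt_trans ac)// ltrDl.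
      apply: le_outer_measure => t []/=; rewrite !in_itv/= => /andP[-> _]/= tc.
      by rewrite (le_lt_trans tc)// ltrDl.
    apply: (@le_trans _ _
        (om (`](c + d')%R, b[%classic `|` `]c, (c + d)%R[%classic))).
      apply: le_outer_measure => t []/=; rewrite !in_itv/= => /andP[at_ tb] /negP.
      rewrite -ltNge => ct; have [h|h] := ltP (c + d')%R t; first by left.
      by right; rewrite /= ?in_itv/= ct/= (le_lt_trans h)// ltrD2l.
    apply: le_trans (outer_measureU2 _ _ _) _; apply: leeD => //.
    exact: outer_mass_itv.
  rewrite addeA leeD2r// -EFinD lee_fin (im_super HW)//; last exact: ltW.
  by rewrite (le_trans ac)// lerDl ltW.
apply: le_caratheodory_measurable => X.
apply: le_ereal_inf_tmp => _ [A [mA XA] <-].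
have HA k : om (A k `&` `]-oo, c]) + om (A k `&` ~` `]-oo, c]) <= hull (A k).
  apply: le_ereal_inf_tmp => _ [[a b] [/= ab Aab] <-].
  by apply: le_trans (Hitv _ _ ab); apply: leeD; apply: le_outer_measure; exact: setSI.
apply: (@le_trans _ _ (\sum_(k <oo) om (A k `&` `]-oo, c]) +
    \sum_(k <oo) om (A k `&` ~` `]-oo, c]))).
  by apply: leeD; (apply: (le_trans _ (outer_measure_sigma_subadditive _ _));
    apply: le_outer_measure; rewrite -setI_bigcupl; exact: setISS).
rewrite -nneseriesD; [|by move=> *; exact: outer_measure_ge0..].
by apply: lee_nneseries => k *; rewrite ?adde_ge0//; exact: outer_measure_ge0.
Qed.

Lemma outer_mass_borel (B : set (measurableTypeR R)) :
  measurable B -> caratheodory_measurable om B.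
Proof.
apply: smallest_sub.
  split => [|X mX|F mF]; first exact: caratheodory_measurable_set0.
    by rewrite setTD; exact: caratheodory_measurable_setC.
  exact: caratheodory_measurable_bigcup.
move=> _ [[a b] _ <-] /=.
rewrite (_ : [set` _] = `]-oo, b] `\` `]-oo, a]).
  exact: caratheodory_measurable_setD (outer_mass_ray b) (outer_mass_ray a).
apply/seteqP; split => t; rewrite /= !in_itv/=.
  by move=> /andP[at_ ->]; split => //; apply/negP; rewrite -ltNge.
by move=> [-> /negP]; rewrite -ltNge => ->.
Qed.

Let mass0 : om set0 = 0. Proof. exact: outer_measure0. Qed.
Let mass_ge0 (A : set (measurableTypeR R)) : 0 <= om A.
Proof. exact: outer_measure_ge0. Qed.
Let mass_sigma_additive :
  semi_sigma_additive (om : set (measurableTypeR R) -> \bar R).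
Proof.
move=> F mF tF mUF; apply: caratheodory_measure_sigma_additive => //.
  by move=> i; exact: outer_mass_borel (mF i).
exact: outer_mass_borel mUF.
Qed.

Definition mass_fun : set (measurableTypeR R) -> \bar R := om.

Definition mass : borel_measure R :=
  HB.pack mass_fun (isMeasure.Build _ (measurableTypeR R) R mass_fun
     mass0 mass_ge0 mass_sigma_additive).

Lemma mass_itv a b : (a < b)%R -> mass `]a, b[%classic <= (W a b)%:E.
Proof. exact: outer_mass_itv. Qed.

Lemma mass_maximal (nu : borel_measure R) :
  (forall a b, (a < b)%R -> nu `]a, b[%classic <= (W a b)%:E) ->
  forall B : set (measurableTypeR R), measurable B -> nu B <= mass B.
Proof.
move=> nuW B mB; apply: le_ereal_inf_tmp => _ [A [mA BA] <-].
apply: (@le_trans _ _ (\sum_(k <oo) nu (A k))).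
  exact: measure_sigma_subadditive.
apply: lee_nneseries => [//|k _].
apply: le_ereal_inf_tmp => _ [[a b] [/= ab Aab] <-].
by apply: le_trans (nuW _ _ ab); apply: le_measure; rewrite ?inE.
Qed.

(** Half of e pays for a nearly optimal cover by sets; the other half, spread as e / 2^(k+2), pays
    for replacing each set by an interval that nearly attains its [hull]. *)
Lemma mass_cover (B : set (measurableTypeR R)) (e : R) :
  mass B < +oo -> (0 < e)%R ->
  exists p : nat -> R * R, [/\ forall k, ((p k).1 < (p k).2)%R,
    B `<=` \bigcup_k `](p k).1, (p k).2[%classic &
    \sum_(k <oo) (W (p k).1 (p k).2)%:E <= mass B + e%:E].
Proof.
move=> Boo e0; have e20 : (0 < e / 2)%R by rewrite divr_gt0.
have Bfin : ereal_inf [set \sum_(k <oo) hull (A k) | A in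
    measurable_cover (B : set (measurableTypeR R))] \is a fin_num.
  by rewrite ge0_fin_numE// -[X in 0 <= X]/(om B) outer_measure_ge0.
have [_ [A [mA BA] <-]] := lb_ereal_inf_adherent e20 Bfin.
rewrite -[ereal_inf _]/(mass B) => hA.
have sumoo : \sum_(k <oo) hull (A k) < +oo.
  by apply: lt_trans hA _; rewrite lte_add_pinfty// ltry.
have /choice[p hp] : forall k, exists q : R * R, [/\ (q.1 < q.2)%R,
    A k `<=` `]q.1, q.2[%classic &
    (W q.1 q.2)%:E <= hull (A k) + (e / 2 / (2 ^ k.+1)%:R)%:E].
  move=> k.
  have kfin : hull (A k) \is a fin_num.
    rewrite ge0_fin_numE//; apply: le_lt_trans sumoo.
    apply: le_trans (nneseries_lim_ge k.+1 (fun n _ _ => hull_ge0 (A n))).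
    by rewrite big_nat_recr//= leeDr// sume_ge0.
  have ek : (0 < e / 2 / (2 ^ k.+1)%:R)%R by rewrite divr_gt0// ltr0n expn_gt0.
  have [_ [[a b] [/= ab Aab] <-]] := lb_ereal_inf_adherent ek kfin.
  by move=> /ltW h; exists (a, b).
exists p; split => [k||]; first by have [] := hp k.
  by apply: subset_trans BA _; apply: subset_bigcup => k _; have [] := hp k.
apply: (@le_trans _ _ (\sum_(k <oo) (hull (A k) + (e / 2 / (2 ^ k.+1)%:R)%:E))).
  apply: lee_nneseries => k *; last by have [] := hp k.
  by have [h _ _] := hp k; rewrite lee_fin (im_ge0 HW)// ltW.
apply: le_trans (epsilon_trick _ _ (ltW e20)) _ => //.
have -> : e%:E = (e / 2)%:E + (e / 2)%:E by rewrite -EFinD -splitr.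
by rewrite addeA leeD2r// ltW.
Qed.

Lemma mass_fin : mass setT <= M%:E.
Proof.
have -> : [set: measurableTypeR R] = \bigcup_n `](- n.+1%:R)%R, n.+1%:R%R[%classic.
  apply/seteqP; split => // t _; exists (Num.truncn `|t|) => //=.
  by rewrite in_itv/= -ltr_norml truncnS_gt.
pose F n : set (measurableTypeR R) := `](- n.+1%:R)%R, n.+1%:R%R[%classic.
have mF n : measurable (F n) by exact: measurable_itv.
have nd : nondecreasing_seq F.
  move=> m n mn; apply/subsetPset => t; rewrite /F/= !in_itv/= -!ltr_norml => /lt_le_trans.
  by apply; rewrite ler_nat.
have cv := @nondecreasing_cvg_mu _ _ _ mass F mF (bigcupT_measurable _ mF) nd.
rewrite -(cvg_lim _ cv)//; apply: lime_le; first by apply/cvg_ex; eexists; exact: cv.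
apply: nearW => n /=; have n0 : (- n.+1%:R < n.+1%:R :> R)%R by rewrite gtrN// ltr0n.
by apply: le_trans (mass_itv n0) _; rewrite lee_fin (im_le HW)// ltW.
Qed.
End outer_measure.

(** * Differentiation of superadditive interval functions *)

Section superadditive_sum.
Variables (R : realType) (E : R -> R -> R).
Hypothesis E_ge0 : forall s t, s <= t -> 0 <= E s t.
Hypothesis E_super : forall r s t, r <= s -> s <= t -> E r s + E s t <= E r t.

(* Induction on the number of intervals: those to the left and those to the
   right of the first one are separated by it. *)
Lemma super_sum_disjoint (I : eqType) (l r : I -> R) (s : seq I) a b :
  a <= b -> uniq s ->
  (forall i, i \in s -> [/\ a <= l i, l i <= r i & r i <= b]) ->
  (forall i j, i \in s -> j \in s -> i != j -> r i < l j \/ r j < l i) ->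
  \sum_(i <- s) E (l i) (r i) <= E a b.
Proof.
elim: {s}(size s) {-2}s (leqnn (size s)) a b => [|n IH] s sn a b ab us sab dis.
  by move: sn; rewrite leqn0 size_eq0 => /eqP ->; rewrite big_nil E_ge0.
case: s => [|i s] in sn us sab dis *; first by rewrite big_nil E_ge0.
have {us} /andP[is_ us] : (i \notin s) && uniq s by [].
have [ai iri ib] := sab i (mem_head _ _).
rewrite big_cons (bigID (fun j => r j < l i))/=.
have sz (P : pred I) : (size [seq j <- s | P j] <= n)%N.
  by rewrite size_filter (leq_trans (count_size _ _)).
have hl : \sum_(j <- s | r j < l i) E (l j) (r j) <= E a (l i).
  rewrite -big_filter; apply: IH => //; first exact: filter_uniq.
    move=> j; rewrite mem_filter => /andP[ji js].
    have [aj rj _] := sab j (mem_behead (s := i :: s) js).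
    by split => //; exact: ltW.
  move=> j k; rewrite !mem_filter => /andP[_ js] /andP[_ ks].
  by apply: dis; rewrite in_cons ?js ?ks orbT.
have hr : \sum_(j <- s | ~~ (r j < l i)) E (l j) (r j) <= E (r i) b.
  rewrite -big_filter; apply: IH => //; first exact: filter_uniq.
    move=> j; rewrite mem_filter => /andP[ji js].
    have [aj rj jb] := sab j (mem_behead (s := i :: s) js).
    split => //; have ij : i != j by apply: contraNneq is_ => ->.
    have [|/ltW//|] := dis i j (mem_head _ _) _ ij; first by rewrite in_cons js orbT.
    by rewrite (negbTE ji).
  move=> j k; rewrite !mem_filter => /andP[_ js] /andP[_ ks].
  by apply: dis; rewrite in_cons ?js ?ks orbT.
have h1 := E_super ai iri; have h2 := E_super (le_trans ai iri) ib; lra.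
Qed.

(** A maximal inequality of weak type. Among the closed intervals in [a, b] on which E exceeds c
    times the length, Vitali's lemma selects disjoint ones whose fivefold enlargements cover them
    all. By superadditivity the selected intervals have total length at most E(a, b) / c. *)
Lemma super_maximal (a b c : R) : a <= b -> 0 < c ->
  exists U : set (measurableTypeR R), [/\ measurable U,
    (@lebesgue_measure R U <= (5 * (E a b / c))%:E)%E &
    forall t r s, a <= r -> r < s -> s <= b -> r <= t <= s ->
      c * (s - r) < E r s -> U t].
Proof.
move=> ab c0.
pose B (i : R * {posnum R}) : set R := ball i.1 i.2%:num.
pose V : set (R * {posnum R}) := [set i | [/\ a <= i.1 - i.2%:num,
  i.1 + i.2%:num <= b &
  c * (2 * i.2%:num) < E (i.1 - i.2%:num) (i.1 + i.2%:num)]].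
have Bball i : is_ball (B i) by exact: is_ball_ball.
have Brad i : (radius (B i))%:num = i.2%:num by rewrite radius_ball_num.
have Brad0 i : 0 < (radius (B i))%:num by rewrite Brad.
have VB i : V i -> (radius (B i))%:num <= b - a.
  move=> [h1 h2 _]; rewrite Brad; (have i0 : 0 < i.2%:num by []); lra.
have [D [/countable_injP[g ginj] DV tD cov]] := vitali_lemma_infinite_cover Bball Brad0 VB.
have clB i : closure (B i) = `[i.1 - i.2%:num, i.1 + i.2%:num]%classic.
  by rewrite closure_ballE closed_ball_itv.
have cl5B i : closure (5%:R *` B i) =
    `[i.1 - 5 * i.2%:num, i.1 + 5 * i.2%:num]%classic.
  by rewrite scale_ballE// closure_ballE closed_ball_itv.
(* Vitali's lemma makes the closed balls disjoint, hence strictly separated: otherwise the larger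
   left endpoint would be common to both. *)
have disj i j : D i -> D j -> i != j ->
    i.1 + i.2%:num < j.1 - j.2%:num \/ j.1 + j.2%:num < i.1 - i.2%:num.
  move=> Di Dj ij.
  have [h|h] := ltP (i.1 + i.2%:num) (j.1 - j.2%:num); first by left.
  have [h'|h'] := ltP (j.1 + j.2%:num) (i.1 - i.2%:num); first by right.
  suff /(tD _ _ Di Dj) eqij : closure (B i) `&` closure (B j) !=set0.
    by rewrite eqij eqxx in ij.
  have i0 : 0 < i.2%:num by [].
  have j0 : 0 < j.2%:num by [].
  exists (Num.max (i.1 - i.2%:num) (j.1 - j.2%:num)); rewrite !clB.
  by split; rewrite /= in_itv/= ge_max le_max !lexx ?orbT/= ?h ?h' ?andbT/=; lra.
(* A partial inverse of the injection [g] from D to the naturals. It enumerates D; an index outside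
   the image of [g] will contribute the empty set. *)
pose h n : option (R * {posnum R}) :=
  if pselect (exists2 i, D i & g i = n) is left e
  then Some (projT1 (cid2 e)) else None.
have hP n i : h n = Some i -> D i /\ g i = n.
  by rewrite /h; case: pselect => // e [<-]; case: cid2.
have hg i : D i -> h (g i) = Some i.
  move=> Di; rewrite /h; case: pselect => [e|]; last by case; exists i.
  by case: cid2 => j /= Dj gij; congr Some; apply: ginj; rewrite ?inE.
pose A n : set (measurableTypeR R) :=
  if h n is Some i then closure (5%:R *` B i) else set0.
have mA n : measurable (A n).
  by rewrite /A; case: (h n) => [i|//]; rewrite cl5B; exact: measurable_itv.
have mUA : measurable (\bigcup_n A n) by exact: bigcupT_measurable.
exists (\bigcup_n A n); split => //.
  apply: le_trans (measure_sigma_subadditive _ mA mUA (@subset_refl _ _)) _.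
  apply: lime_le; first exact: is_cvg_nneseries.
  apply: nearW => N.
  have -> : (\sum_(0 <= n < N) @lebesgue_measure R (A n) =
      \sum_(i <- pmap h (index_iota 0 N)) (5 * (2 * i.2%:num))%:E)%E.
    elim: (index_iota 0 N) => [|n t ih]; first by rewrite !big_nil.
    rewrite big_cons ih /=; rewrite /A; case: (h n) => [i|] /=; last first.
      by rewrite measure0 add0e.
    rewrite big_cons; congr (_ + _)%E.
    rewrite cl5B lebesgue_measure_itv/= lte_fin ifT.
      by rewrite -EFinB; congr EFin; ring.
    by (have i0 : 0 < i.2%:num by []); lra.
  rewrite sumEFin lee_fin -mulr_sumr ler_pM2l// ler_pdivlMr//.
  apply: (@le_trans _ _ (\sum_(i <- pmap h (index_iota 0 N))
      E (i.1 - i.2%:num) (i.1 + i.2%:num))).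
    rewrite mulr_suml big_seq [leRHS]big_seq; apply: ler_sum => i.
    rewrite mem_pmap => /mapP[n _ /esym/hP[Di _]].
    by have [_ _ /ltW] := DV _ Di; rewrite mulrC.
  apply: super_sum_disjoint => //.
  - apply: (@pmap_uniq _ _ h g); last exact: iota_uniq.
    by move=> n; case hn : (h n) => [i|//] /=; have [] := hP _ _ hn.
  - move=> i; rewrite mem_pmap => /mapP[n _ /esym/hP[Di _]].
    have [h1 h2 _] := DV _ Di; split => //; (have i0 : 0 < i.2%:num by []); lra.
  - move=> i j; rewrite !mem_pmap => /mapP[n _ /esym/hP[Di _]].
    by move=> /mapP[m _ /esym/hP[Dj _]]; exact: disj.
move=> t r s ar rs sb /andP[rt ts] cE.
have d0 : 0 < (s - r) / 2 by rewrite divr_gt0// subr_gt0.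
have Vi : V ((r + s) / 2, PosNum d0).
  have e1 : (r + s) / 2 - (s - r) / 2 = r by field.
  have e2 : (r + s) / 2 + (s - r) / 2 = s by field.
  rewrite /V/= e1 e2; split => //.
  by rewrite (_ : 2 * ((s - r) / 2) = s - r)//; field.
have [|i Di ti] := cov t.
  exists ((r + s) / 2, PosNum d0) => //; rewrite /= clB/= in_itv/=.
  by apply/andP; split; lra.
by exists (g i) => //; rewrite /A hg.
Qed.
End superadditive_sum.

Definition density_measure_fun (R : realType) (f : R -> \bar R)
    (A : set (measurableTypeR R)) : \bar R :=
  (\int[lebesgue_measure]_(t in A) f t)%E.

Section density_measure.
Variables (R : realType) (f : R -> \bar R).
Hypotheses (mf : measurable_fun [set: measurableTypeR R] (f : measurableTypeR R -> \bar R))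
  (f0 : forall t, (0 <= f t)%E).

Let d0 : density_measure_fun f set0 = 0%E.
Proof. by rewrite /density_measure_fun integral_set0. Qed.
Let d_ge0 A : (0 <= density_measure_fun f A)%E.
Proof. by apply: integral_ge0 => t _; exact: f0. Qed.

Definition density_measure : borel_measure R :=
  HB.pack (density_measure_fun f) (isMeasure.Build _ (measurableTypeR R) R
    (density_measure_fun f) d0 d_ge0
    (semi_sigma_additive_nng_induced mf f0)).

Lemma density_measureE A :
  density_measure A = (\int[lebesgue_measure]_(t in A) f t)%E.
Proof. by []. Qed.
End density_measure.

Lemma negligible_small (R : realType) (A : set (measurableTypeR R)) :
  (forall e : R, 0 < e -> exists U : set (measurableTypeR R),
     [/\ measurable U, A `<=` U & (lebesgue_measure U <= e%:E)%E]) ->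
  (@lebesgue_measure R).-negligible A.
Proof.
move=> H; have /choice[U hU] : forall n : nat, exists U : set (measurableTypeR R),
    [/\ measurable U, A `<=` U & (lebesgue_measure U <= (n.+1%:R^-1 : R)%:E)%E].
  by move=> n; apply: H; rewrite invr_gt0.
exists (\bigcap_n U n); split.
- by apply: bigcapT_measurable => n; have [] := hU n.
- apply/eqP; rewrite eq_le measure_ge0 andbT; apply/lee_addgt0Pr => e e0.
  rewrite add0e; near \oo => n; have [mU _ Un] := hU n.
  apply: (@le_trans _ _ (lebesgue_measure (U n))).
    apply: le_measure; rewrite ?inE//; last exact: bigcap_inf.
    by apply: bigcapT_measurable => k; have [] := hU k.
  apply: le_trans Un _; rewrite lee_fin; apply: ltW; near: n.
  exact: (near_infty_natSinv_lt (PosNum e0)).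
- by move=> t At n _; have [_ + _] := hU n; apply.
Unshelve. all: by end_near. Qed.

(** * Almost everywhere derivative of W *)

Section density.
Variables (R : realType) (W : R -> R -> R) (M : R) (HW : interval_mass W M).
Variables (rho : R -> R) (mus : borel_measure R).
Hypothesis dec : lebesgue_decomposition (mass HW) rho mus.

Let mrho : measurable_fun [set: measurableTypeR R] (rho : measurableTypeR R -> R).
Proof. by case: dec. Qed.
Let rho0 t : 0 <= rho t. Proof. by case: dec. Qed.
Let mErho : measurable_fun [set: measurableTypeR R]
  (EFin \o rho : measurableTypeR R -> \bar R).
Proof. exact/measurable_EFinP. Qed.
Let Erho0 t : (0 <= (EFin \o rho) t)%E. Proof. by rewrite lee_fin. Qed.

Lemma integral_density_le (B : set (measurableTypeR R)) : measurable B ->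
  (\int[lebesgue_measure]_(t in B) (rho t)%:E <= mass HW B)%E.
Proof. by case: dec => _ _ _ h mB; rewrite h// leeDl. Qed.

Lemma integrable_density (B : set (measurableTypeR R)) : measurable B ->
  lebesgue_measure.-integrable B (EFin \o rho).
Proof.
move=> mB; apply: (integrableS measurableT) => //.
apply/integrableP; split; first exact: mErho.
under eq_integral do rewrite /= ger0_norm//.
apply: le_lt_trans (integral_density_le measurableT) _.
by apply: le_lt_trans (mass_fin HW) _; rewrite ltry.
Qed.

Let J r s : R := \int[lebesgue_measure]_(t in `]r, s[) rho t.

Lemma JE r s : (\int[lebesgue_measure]_(t in `]r, s[) (rho t)%:E)%E = (J r s)%:E.
Proof.
rewrite fineK//; apply: integrable_fin_num => //.
by apply: integrable_density; exact: measurable_itv.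
Qed.

Lemma density_itv_le r s : r < s -> J r s <= W r s.
Proof.
move=> rs; rewrite -lee_fin -JE.
by apply: le_trans (integral_density_le (measurable_itv _)) (mass_itv HW rs).
Qed.

Let J0 s : J s s = 0.
Proof. by rewrite /J set_itv_ge ?Rintegral_set0// bnd_simp ltxx. Qed.

(** The excess of W over the absolutely continuous part of the mass. It inherits superadditivity
    because J is additive, single points being Lebesgue-null. *)
Let E r s := W r s - J r s.

Let E_ge0 r s : r <= s -> 0 <= E r s.
Proof.
rewrite le_eqVlt => /predU1P[->|rs]; last by rewrite subr_ge0 density_itv_le.
by rewrite /E J0 subr0 (im_ge0 HW).
Qed.

Let E_super r s t : r <= s -> s <= t -> E r s + E s t <= E r t.
Proof.
move=> rs; rewrite le_eqVlt => /predU1P[<-|st].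
  have := im_super HW rs (lexx s).
  by rewrite /E J0; lra.
have i1 : lebesgue_measure.-integrable `]r, t[ (EFin \o rho).
  by apply: integrable_density; exact: measurable_itv.
have := @Rintegral_itvB _ rho (BRight r) (BLeft t) s i1.
rewrite !bnd_simp => /(_ rs st).
rewrite -(Rintegral_itv_bndo_bndc (a := BRight r) (r := s)); last first.
  by apply: integrable_density; exact: measurable_itv.
have := im_super HW rs (ltW st).
rewrite /E /J; lra.
Qed.

Let badset (c : R) : set (measurableTypeR R) := [set t | forall d, 0 < d -> exists r s,
  [/\ r < s, r <= t <= s, t - d < r, s < t + d & c * (s - r) < E r s]].

(** Off the Lebesgue-null set Z that carries [mus], the mass is the integral of [rho]. A nearly
    optimal cover of the complement of Z therefore has little total excess, and [super_maximal] on
    each of its intervals bounds the measure of the bad points there. *)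
Let badset_negligible c : 0 < c -> (@lebesgue_measure R).-negligible (badset c).
Proof.
move=> c0; have [_ _ [Z [mZ Z0 musZ]] muE] := dec.
suff : (@lebesgue_measure R).-negligible (badset c `\` Z).
  move=> nb; apply: (@negligibleS _ _ _ _ ((badset c `\` Z) `|` Z)).
    by move=> t bt; have [Zt|nZt] := pselect (Z t); [right|left].
  by apply: negligibleU => //; exact/negligibleP.
apply: negligible_small => e e0.
(* Compensates the factor 5 / c of [super_maximal]. *)
pose eta := c * e / 5.
have eta0 : 0 < eta by rewrite divr_gt0// mulr_gt0.
have mZC : measurable (~` Z) by exact: measurableC.
have Zoo : (mass HW (~` Z) < +oo)%E.
  apply: (@le_lt_trans _ _ M%:E); last exact: ltry.
  by apply: le_trans (mass_fin HW); apply: le_measure; rewrite ?inE.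
have [p [plt pcov psum]] := mass_cover Zoo eta0.
have Ep0 k : 0 <= E (p k).1 (p k).2 by apply: E_ge0; exact: ltW.
have sumE : (\sum_(k <oo) (E (p k).1 (p k).2)%:E <= eta%:E)%E.
  pose nu := @density_measure _ (EFin \o rho) mErho Erho0.
  have nuZ : nu (~` Z) = mass HW (~` Z) by rewrite muE// musZ adde0.
  have nufin : nu (~` Z) \is a fin_num by rewrite ge0_fin_numE// nuZ.
  rewrite -(leeD2lE _ _ nufin) [leRHS](_ : _ = mass HW (~` Z) + eta%:E)%E; last by rewrite nuZ.
  apply: (le_trans _ psum).
  rewrite [leRHS](_ : _ = (\sum_(k <oo) ((J (p k).1 (p k).2)%:E +
      (E (p k).1 (p k).2)%:E))%E); last first.
    by apply: eq_eseriesr => k _; rewrite -EFinD; congr EFin; rewrite /E; ring.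
  have Jk0 k : (0 <= (J (p k).1 (p k).2)%:E)%E.
    by rewrite lee_fin; apply: Rintegral_ge0 => t _; exact: rho0.
  rewrite nneseriesD//; last by move=> k _; rewrite lee_fin.
  apply: leeD => //.
  apply: le_trans (measure_sigma_subadditive nu _ mZC pcov) _.
    by move=> k; exact: measurable_itv.
  rewrite le_eqVlt; apply/predU1P; left; apply: eq_eseriesr => k _.
  exact: JE.
have /choice[U hU] := fun k => super_maximal E_ge0 E_super (ltW (plt k)) c0.
have mU k : measurable (U k) by have [] := hU k.
have mUU : measurable (\bigcup_k U k) by exact: bigcupT_measurable.
exists (\bigcup_k U k); split => //.
  move=> t [bt Zt]; have [k _] := pcov t Zt.
  rewrite /= in_itv/= => /andP[at_ tb].
  exists k => //; have [_ _] := hU k; pose d := Num.min (t - (p k).1) ((p k).2 - t).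
  have d0 : 0 < d by rewrite lt_min !subr_gt0 at_.
  have [r [s [rs rts tr st cE]]] := bt d d0; move/(_ t r s); apply => //.
    have : d <= t - (p k).1 by rewrite ge_min lexx.
    lra.
  have : d <= (p k).2 - t by rewrite ge_min lexx orbT.
  lra.
apply: le_trans (measure_sigma_subadditive _ mU mUU (@subset_refl _ _)) _.
apply: (@le_trans _ _ (\sum_(k <oo) (5 / c)%:E * (E (p k).1 (p k).2)%:E)%E).
  apply: lee_nneseries => // k _; have [_ h _] := hU k.
  apply: le_trans h _; rewrite -EFinM lee_fin.
  by rewrite le_eqVlt; apply/orP; left; apply/eqP; ring.
rewrite nneseriesZl//; last by move=> k _; rewrite lee_fin.
apply: (@le_trans _ _ ((5 / c)%:E * eta%:E)%E).
  by apply: lee_wpmul2l => //; rewrite lee_fin divr_ge0// ltW.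
rewrite -EFinM lee_fin /eta le_eqVlt; apply/orP; left; apply/eqP.
by field; rewrite gt_eqF.
Qed.

(** From centred balls to intervals that merely contain t: ]r, s[ lies in the ball about t of radius
    2 (s - r), whose length is 4 (s - r). Hence the tolerance e / 4; and s - r < 2 d keeps that
    radius below 4 d. *)
Lemma lebesgue_pt_itv t : lebesgue_pt rho t -> forall e, 0 < e ->
  exists2 d, 0 < d & forall r s, r < s -> r <= t <= s -> t - d < r ->
    s < t + d -> `|J r s - rho t * (s - r)| <= e * (s - r).
Proof.
move=> lpt e e0; have e40 : 0 < e / 4 by rewrite divr_gt0.
have /fine_cvgP[dfin /cvgrPdist_le/(_ _ e40) dle] := lpt.
move: dfin dle => -[d1 /= d10 dfin] [d2 /= d20 dle].
exists (Num.min d1 d2 / 4).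
  by rewrite divr_gt0// lt_min d10.
move=> r s rs /andP[rt ts] tr st.
have m1 : Num.min d1 d2 <= d1 by rewrite ge_min lexx.
have m2 : Num.min d1 d2 <= d2 by rewrite ge_min lexx orbT.
have u0 : 0 < 2 * (s - r) by lra.
have bu1 : ball_ [eta @Num.norm _ R] (0 : R) d1 (2 * (s - r)).
  by rewrite /ball_/= sub0r normrN gtr0_norm//; lra.
have bu2 : ball_ [eta @Num.norm _ R] (0 : R) d2 (2 * (s - r)).
  by rewrite /ball_/= sub0r normrN gtr0_norm//; lra.
have := dle _ bu2 u0; have {}dfin := dfin _ bu1 u0.
rewrite sub0r normrN => h.
have {h} : (davg rho t (2 * (s - r)) <= (e / 4)%:E)%E.
  by rewrite -[leLHS]fineK// lee_fin (le_trans (ler_norm _)).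
rewrite /davg /iavg/= lebesgue_measure_ball ?(ltW u0)//.
have m20 : 0 < 2 * (s - r) *+ 2 by rewrite mulrn_wgt0.
rewrite inver gt_eqF// lee_pdivrMl// -EFinM => h.
rewrite -lee_fin.
have mI : measurable (`]r, s[%classic : set (measurableTypeR R)) by exact: measurable_itv.
have icst : (@lebesgue_measure R).-integrable `]r, s[ (EFin \o cst (rho t)).
  apply: measurable_bounded_integrable => //=; last exact: bounded_cst.
  by rewrite lebesgue_measure_itv/=; case: ifP => _; rewrite -?EFinB ltry.
have H2 : (\int[lebesgue_measure]_(x in `]r, s[) (rho t)%:E = (rho t * (s - r))%:E)%E.
  by rewrite integral_cst//= lebesgue_measure_itv/= lte_fin rs -EFinB -EFinM.
have H1 : (\int[lebesgue_measure]_(x in `]r, s[) ((rho x)%:E - (rho t)%:E) =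
    (J r s - rho t * (s - r))%:E)%E.
  apply: etrans (integralB_EFin mI (integrable_density mI) icst) _.
  by rewrite [X in (_ - X)%E]H2 EFinB; congr (_ - _)%E; exact: JE.
have -> : (`|J r s - rho t * (s - r)|%:E = `|\int[lebesgue_measure]_(x in `]r, s[)
    ((rho x)%:E - (rho t)%:E)|)%E by rewrite H1.
have md : measurable_fun [set: R] (fun x => (rho x)%:E - (rho t)%:E)%E.
  by apply: emeasurable_funB => //; exact: measurable_cst.
apply: le_trans (le_abse_integral _ _ _) _ => //; first exact: measurable_funTS md.
apply: (@le_trans _ _ (\int[lebesgue_measure]_(x in ball t (2 * (s - r))%R)
    `|(rho x)%:E - (rho t)%:E|)%E).
  apply: ge0_subset_integral => //; first exact: measurable_ball.
    by apply: measurableT_comp => //; exact: measurable_funTS md.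
  move=> x; rewrite /= in_itv/= /ball/= => /andP[rx xs].
  by rewrite ltr_norml; apply/andP; split; lra.
apply: le_trans h _; rewrite lee_fin le_eqVlt; apply/orP; left; apply/eqP.
by rewrite -mulr_natl; field.
Qed.

(** In W = J + E the first term is governed by Lebesgue differentiation, the second by the sets
    [badset] for the countably many thresholds 1/(n+1). The estimate is uniform over all short
    intervals containing t, so that it serves both sequences of intervals and blocks of
    partitions. *)
Theorem density_limit : {ae @lebesgue_measure R, forall t : R,
  forall e, 0 < e -> exists2 d, 0 < d & forall r s, r < s -> r <= t <= s ->
    t - d < r -> s < t + d -> `|W r s - rho t * (s - r)| <= e * (s - r)}.
Proof.
have locrho : locally_integrable [set: R] rho.
  by apply: open_integrable_locally; [exact: openT|exact: integrable_density].
have h1 := lebesgue_differentiation locrho.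
have h2 : {ae @lebesgue_measure R, forall t n, ~ badset n.+1%:R^-1 t}.
  apply: ae_foralln => n; have n0 : 0 < n.+1%:R^-1 :> R by rewrite invr_gt0.
  apply: negligibleS (badset_negligible n0) => t /= nb.
  exact: contrapT.
have FF := ae_filter_ringOfSetsType (@lebesgue_measure R).
apply: (@filterS2 _ _ FF _ _ _ _ h1 h2) => t lpt gt e e0.
have e20 : 0 < e / 2 by rewrite divr_gt0.
have [d1 d10 hd1] := lebesgue_pt_itv lpt e20.
near \oo => n; have ne : n.+1%:R^-1 < e / 2.
  by near: n; exact: (near_infty_natSinv_lt (PosNum e20)).
have /existsNP[d2 /not_implyP[d20 hd2]] := gt n.
exists (Num.min d1 d2); first by rewrite lt_min d10.
move=> r s rs rts tr st.
have m1 : Num.min d1 d2 <= d1 by rewrite ge_min lexx.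
have m2 : Num.min d1 d2 <= d2 by rewrite ge_min lexx orbT.
have := hd1 r s rs rts; have -> : t - d1 < r by lra. have -> : s < t + d1 by lra.
move=> /(_ isT isT) hJ.
have hE : E r s <= n.+1%:R^-1 * (s - r).
  rewrite leNgt; apply/negP => cE; apply: hd2; exists r, s; split => //; lra.
have hE0 := E_ge0 (ltW rs).
have h3 : n.+1%:R^-1 * (s - r) <= e / 2 * (s - r).
  by apply: ler_wpM2r; [lra|exact: ltW].
have -> : W r s - rho t * (s - r) = E r s + (J r s - rho t * (s - r)) by rewrite /E; ring.
apply: (le_trans (ler_normD _ _)); rewrite [`|E r s|]ger0_norm//.
rewrite (_ : e * (s - r) = e / 2 * (s - r) + e / 2 * (s - r)); last by field.
by apply: lerD => //; exact: le_trans hE h3.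
Unshelve. all: by end_near. Qed.
End density.

(** * The power utilities *)

Section utility.
Variables (R : realType) (q : R).
Hypotheses (q0 : q != 0) (q1 : q < 1).

(** With w = e^x only e^y >= 1 + y is used. For q < 0 it is applied at qx and at x. For 0 < q < 1,
    division by e^(qx) leaves q e^((1-q)x) + (1-q) e^(-qx) >= 1, where the terms linear in x
    cancel. *)
Lemma powR_tangent1 w : 0 < w -> w `^ q / q <= q^-1 + (w - 1).
Proof.
move=> w0; rewrite /powR gt_eqF// -{2}(lnK (x := w)) ?posrE//.
move: (ln w) => x {w w0}.
have [qn|qp] := ltP q 0.
  have h1 := expR_ge1Dx (q * x); have h2 := expR_ge1Dx x.
  rewrite -(@ler_nM2r _ q)// mulfVK// mulrDl mulVf//.
  have : (expR x - (1 + x)) * q <= 0 by apply: mulr_ge0_le0; [lra|exact: ltW].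
  lra.
have {}qp : 0 < q by rewrite lt_neqAle eq_sym q0.
rewrite -(@ler_pM2r _ q)// mulfVK ?gt_eqF// mulrDl mulVf ?gt_eqF//.
have h1 := expR_ge1Dx (x - q * x); have h2 := expR_ge1Dx (- (q * x)).
have e1 : expR x = expR (q * x) * expR (x - q * x) by rewrite -expRD; congr expR; ring.
have e2 : 1 = expR (q * x) * expR (- (q * x)) by rewrite expRN divff// gt_eqF// expR_gt0.
have e0 := expR_gt0 (q * x).
have {}h1 : 0 <= q * (expR (x - q * x) - (1 + (x - q * x))).
  by apply: mulr_ge0; [exact: ltW|rewrite subr_ge0].
have {}h2 : 0 <= (1 - q) * (expR (- (q * x)) - (1 - q * x)).
  by apply: mulr_ge0; rewrite subr_ge0//; exact: ltW.
have : 0 <= expR (q * x) * (q * expR (x - q * x) + (1 - q) * expR (- (q * x)) - 1).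
  by apply: mulr_ge0; [exact: ltW|lra].
rewrite mulrBr mulrDr mulr1 !(mulrCA (expR (q * x))) -e1 -e2; lra.
Qed.

Let slope (z0 : R) := z0 `^ (q - 1).

Lemma slope_ge0 z0 : 0 <= slope z0. Proof. exact: powR_ge0. Qed.

Lemma slopeM z0 : 0 < z0 -> slope z0 * z0 = z0 `^ q.
Proof.
move=> z0p; rewrite -[X in _ * X]powRr1 ?ltW// -powRD ?subrK//.
by rewrite (gt_eqF z0p) implybT.
Qed.

(** For z > 0 this is [powR_tangent1] at z / z0, scaled by z0^q. At z = 0 the tangent takes the
    value z0^q (1/q - 1), which is nonnegative for 0 < q < 1, while u_q(0) = -oo for q < 0. *)
Lemma u_tangent z0 z : 0 < z0 -> 0 <= z ->
  (u_ q z <= (z0 `^ q / q + z0 `^ (q - 1) * (z - z0))%:E)%E.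
Proof.
move=> z0p zge; rewrite /u_; have [->|zn0] := eqVneq z 0.
  case: ifPn => [_|]; first by rewrite leNye.
  rewrite -leNgt => qge; have {qge} qp : 0 < q by rewrite lt_neqAle eq_sym q0.
  rewrite lee_fin sub0r mulrN -/(slope z0) slopeM// -{2}[_ `^ q]mul1r mulrC -mulrBl.
  rewrite mulr_ge0 ?powR_ge0// subr_ge0 invf_ge1//; exact: ltW.
have {zge zn0} zp : 0 < z by rewrite lt_neqAle eq_sym zn0.
have wp : 0 < z / z0 by rewrite divr_gt0.
rewrite lee_fin; have zq := powR_gt0 q z0p.
have h : z0 `^ q * ((z / z0) `^ q / q) <= z0 `^ q * (q^-1 + (z / z0 - 1)).
  by rewrite ler_pM2l//; exact: powR_tangent1.
have e1 : z0 `^ q * (z / z0) `^ q = z `^ q.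
  by rewrite -powRM; [rewrite mulrC divfK ?gt_eqF|exact: ltW|exact: ltW].
rewrite mulrA e1 in h; apply: (le_trans h).
rewrite mulrDr lerD2l -{1}(slopeM z0p) -/(slope z0) -mulrA; apply: ler_wpM2l.
  exact: slope_ge0.
by rewrite mulrBr mulr1 mulrC divfK ?gt_eqF.
Qed.

(** The tangent at the point where the derivative z0^(q-1) equals e. The slope can be prescribed
    arbitrarily small, which later keeps the linear term under control by the total cost M. *)
Lemma u_majorant (e : R) : 0 < e -> exists2 C, 0 <= C &
  forall z, 0 <= z -> (u_ q z <= (e * z + C)%:E)%E.
Proof.
move=> e0; pose z0 := e `^ (q - 1)^-1.
have z0p : 0 < z0 by exact: powR_gt0.
have sl : z0 `^ (q - 1) = e.
  by rewrite -powRrM mulVf ?powRr1 ?ltW// subr_eq0 lt_eqF.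
exists (Num.max 0 (z0 `^ q / q - e * z0)); first by rewrite le_max lexx.
move=> z zge; apply: le_trans (u_tangent z0p zge) _; rewrite sl lee_fin.
have : z0 `^ q / q - e * z0 <= Num.max 0 (z0 `^ q / q - e * z0).
  by rewrite le_max lexx orbT.
lra.
Qed.

(* Tangent at z if z > 0; at z = 0, where u_q may be -oo, tangent at a point z0
   so small that the value of the tangent at 0, z0^q (1/q - 1), is below y. *)
Lemma u_usc (z y : R) : 0 <= z -> (u_ q z < y%:E)%E ->
  exists2 d, 0 < d & forall z', 0 <= z' -> `|z' - z| <= d -> (u_ q z' <= y%:E)%E.
Proof.
move=> zge uy.
suff [z0 [L [z0p Ly HL]]] : exists z0 L, [/\ 0 < z0, L < y &
    z0 `^ q / q + z0 `^ (q - 1) * (z - z0) = L].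
  have sp : 0 < z0 `^ (q - 1) by exact: powR_gt0.
  exists ((y - L) / z0 `^ (q - 1)); first by rewrite divr_gt0 ?subr_gt0.
  move=> z' z'ge zz; apply: le_trans (u_tangent z0p z'ge) _; rewrite lee_fin.
  have : z0 `^ (q - 1) * (z' - z) <= y - L.
    rewrite mulrC -ler_pdivlMr//; exact: le_trans (ler_norm _) zz.
  by move: HL; move: (z0 `^ (q - 1)) => D; nra.
have [ze|zn] := eqVneq z 0; last first.
  exists z, (z `^ q / q); split; first by rewrite lt_neqAle eq_sym zn.
    by move: uy; rewrite /u_ (negbTE zn) lte_fin.
  by rewrite subrr mulr0 addr0.
(* The tangent at z0 takes the value z0^q k at 0. Setting this equal to y' gives z0 = (y' /
   k)^(1/q), so y' must be below y and have the sign of k: negative for q < 0, positive for 0 < q <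
   1, where y > u_q(0) = 0. *)
pose k := q^-1 - 1.
have [y' [y'y y'k]] : exists y', y' < y /\ 0 < y' / k.
  have [qn|qp] := ltP q 0.
    exists (Num.min y 0 - 1); have h1 : Num.min y 0 <= y by rewrite ge_min lexx.
    have h2 : Num.min y 0 <= 0 by rewrite ge_min lexx orbT.
    have k0 : k < 0 by rewrite /k; (have : q^-1 < 0 by rewrite invr_lt0); lra.
    split; first lra.
    by rewrite -mulrNN; apply: mulr_gt0; rewrite oppr_gt0 ?invr_lt0//; lra.
  have {}qp : 0 < q by rewrite lt_neqAle eq_sym q0.
  have yp : 0 < y by move: uy; rewrite /u_ ze eqxx (lt_gtF qp) lte_fin.
  exists (y / 2); split; first lra.
  by rewrite divr_gt0 ?divr_gt0// subr_gt0 invf_gt1.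
have kn : k != 0 by apply/eqP => k0; move: y'k; rewrite k0 invr0 mulr0 ltxx.
exists ((y' / k) `^ q^-1), y'; split => //; first exact: powR_gt0.
have z0p : 0 < (y' / k) `^ q^-1 by exact: powR_gt0.
rewrite ze sub0r mulrN -/(slope _) slopeM//.
rewrite -powRrM mulVf// powRr1 ?ltW//.
rewrite -{2}[y' / k]mulr1 -mulrBr -/k divfK//.
Qed.

Lemma measurable_u : measurable_fun [set: R] (u_ q).
Proof.
apply: measurable_fun_ifT.
- exact: measurable_fun_eqr.
- by case: ifP => _; exact: measurable_cst.
- apply/measurable_EFinP; apply: measurable_funM => //; exact: measurable_cst.
Qed.

(** The constant sign keeps the integrals of u_q additive although they may be infinite. *)
Lemma u_sign : (forall z, 0 <= z -> (0 <= u_ q z)%E) \/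
  (forall z, 0 <= z -> (u_ q z <= 0)%E).
Proof.
have [qn|qp] := ltP q 0; [right|left] => z zge; rewrite /u_.
  by case: ifPn => _; rewrite ?qn ?leNye// lee_fin nmulr_lle0 ?powR_ge0// invr_lt0.
by rewrite (le_gtF qp); case: ifPn => // _; rewrite lee_fin divr_ge0// powR_ge0.
Qed.

(** The tangent inequality multiplied by d. The bound is linear in the length d and the mass w,
    hence adds up over adjacent blocks. *)
Lemma u_block (d w z0 : R) : 0 < d -> 0 <= w -> 0 < z0 ->
  (d%:E * u_ q (w / d) <=
    (d * (z0 `^ q / q - z0 `^ (q - 1) * z0) + z0 `^ (q - 1) * w)%:E)%E.
Proof.
move=> d0 w0 z0p; have h : 0 <= w / d by rewrite divr_ge0// ltW.
apply: (le_trans (lee_wpmul2l _ (u_tangent z0p h))); first by rewrite lee_fin ltW.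
rewrite -EFinM lee_fin le_eqVlt; apply/orP; left; apply/eqP.
by field; rewrite q0 gt_eqF.
Qed.
End utility.

(** * Sums over partitions *)

Lemma path_lt_le_last (R : realDomainType) (a x : R) s :
  path <%R a s -> x \in a :: s -> x <= last a s.
Proof.
move=> pas; rewrite in_cons => /predU1P[->|].
  case: s pas => // y s pas; apply: ltW.
  by move/order_path_min : pas => /(_ lt_trans)/allP; apply; rewrite /= mem_last.
move=> xs; move: pas; case/path.splitP: xs => s1 s2; rewrite cat_path last_cat !last_rcons => /andP[_].
case: s2 => // y s3 pas; apply: ltW.
by move/order_path_min : pas => /(_ lt_trans)/allP; apply; rewrite /= mem_last.
Qed.

Section partition_sum.
Variables (R : realType) (F : R -> R -> \bar R).

Definition psum (a : R) (s : seq R) : \bar R :=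
  (\sum_(i < size s) F (nth 0%R (a :: s) i) (nth 0%R (a :: s) i.+1))%E.

Lemma psum_nil a : psum a [::] = 0%E. Proof. by rewrite /psum big_ord0. Qed.

Lemma psum_cons a x s : psum a (x :: s) = (F a x + psum x s)%E.
Proof. by rewrite /psum big_ord_recl. Qed.

Lemma psum_cat a s1 s2 : psum a (s1 ++ s2) = (psum a s1 + psum (last a s1) s2)%E.
Proof.
elim: s1 a => [|x s1 IH] a; first by rewrite psum_nil add0e.
by rewrite /= !psum_cons IH addeA.
Qed.

Hypothesis F_super : forall a b c, a < b -> b < c -> (F a b + F b c <= F a c)%E.

Lemma psum_le a s : s != [::] -> path <%R a s -> (psum a s <= F a (last a s))%E.
Proof.
elim: s a => [//|x s IH] a _ /= /andP[ax xs]; rewrite psum_cons.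
case: s => [|y s] in IH xs *; first by rewrite psum_nil adde0.
have xl : x < last x (y :: s).
  by move/order_path_min : xs => /(_ lt_trans)/allP; apply; rewrite /= mem_last.
apply: le_trans (F_super ax xl); apply: leeD => //; exact: IH.
Qed.

(** Induction on the coarse partition: its first point x cuts the fine one in two. [psum_le] merges
    the fine blocks up to x, and the remaining ones refine the tail of the coarse partition. *)
Lemma psum_refine a P Q : path <%R a P -> path <%R a Q ->
  last a P = last a Q -> {subset Q <= P} -> (psum a P <= psum a Q)%E.
Proof.
elim: Q a P => [|x Q IH] a P pP pQ lPQ sub.
  case: P pP lPQ {sub} => // y P /= pP ly.
  have /allP/(_ (last y P)) := order_path_min lt_trans (pP : path <%R a (y :: P)).
  by rewrite mem_last ly ltxx => /(_ isT).
have xP : x \in P by apply: sub; rewrite mem_head.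
case/path.splitP: xP pP lPQ sub => P1 P2 pP lPQ sub.
rewrite psum_cat psum_cons last_rcons.
move: pP; rewrite cat_path last_rcons => /andP[pP1 pP2].
move: pQ => /= /andP[ax pQ].
apply: leeD.
  rewrite -[in F a x](last_rcons a P1 x); apply: psum_le => //.
  by rewrite -size_eq0 size_rcons.
apply: IH => //; first by move: lPQ; rewrite last_cat last_rcons.
move=> y yQ; have xy : x < y.
  by move: yQ; apply/allP; exact: order_path_min lt_trans pQ.
have := sub y; rewrite in_cons yQ orbT mem_cat => /(_ isT) /orP[|//].
rewrite mem_rcons in_cons => /predU1P[yx|yP1].
  by rewrite yx ltxx in xy.
move: pP1; rewrite (path_pairwise lt_trans) -rcons_cons pairwise_rcons.
move=> /andP[/allP/(_ y)]; rewrite in_cons yP1 orbT => /(_ isT) yx _.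
by have := lt_trans xy yx; rewrite ltxx.
Qed.

End partition_sum.

(** Positive and negative parts are compared separately, which also covers infinite integrals. *)
Lemma le_integral_measurable d (X : measurableType d) (R : realType)
    (mu : {measure set X -> \bar R}) (D : set X) (f g : X -> \bar R) :
  measurable D -> measurable_fun D f -> measurable_fun D g ->
  (forall x, D x -> (f x <= g x)%E) ->
  (\int[mu]_(x in D) f x <= \int[mu]_(x in D) g x)%E.
Proof.
move=> mD mf mg fg; rewrite integralE [leRHS]integralE leeB//.
- apply: ge0_le_integral => //.
  + exact: measurable_funepos.
  + exact: measurable_funepos.
  + by move=> x Dx; rewrite !funeposE; apply: le_max2 => //; exact: fg.
- apply: ge0_le_integral => //.
  + exact: measurable_funeneg.
  + exact: measurable_funeneg.
  + by move=> x Dx; rewrite !funenegE; apply: le_max2 => //; rewrite leeN2; exact: fg.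
Qed.

Definition one_signed (T : Type) (R : realType) (f : T -> \bar R) :=
  (forall x, (0 <= f x)%E) \/ (forall x, (f x <= 0)%E).

Lemma one_signed_integral_itv_setU (R : realType) (f : R -> \bar R) (a b c : R) :
  measurable_fun [set: R] f -> one_signed f -> a <= b -> b <= c ->
  (\int[lebesgue_measure]_(t in `]a, c]) f t =
   \int[lebesgue_measure]_(t in `]a, b]) f t +
   \int[lebesgue_measure]_(t in `]b, c]) f t)%E.
Proof.
move=> mf sf ab bc.
have hg (g : R -> \bar R) : measurable_fun [set: R] g -> (forall x, (0 <= g x)%E) ->
  (\int[lebesgue_measure]_(t in `]a, c]) g t =
   \int[lebesgue_measure]_(t in `]a, b]) g t +
   \int[lebesgue_measure]_(t in `]b, c]) g t)%E.
  move=> mg g0; rewrite (@itv_bndbnd_setU _ _ (BRight a) (BRight b)) ?bnd_simp//.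
  rewrite ge0_integral_setU//=; try exact: measurable_itv.
    exact: measurable_funTS.
  apply/eqP/seteqP; split => // t [/=]; rewrite !in_itv/= => /andP[_ tb] /andP[bt _].
  by have := le_lt_trans tb bt; rewrite ltxx.
case: sf => s; first exact: hg.
have f0 x : (0 <= - f x)%E by rewrite oppe_ge0.
have := hg (fun x => - f x)%E (measurableT_comp (@oppe_measurable R setT) mf) f0.
have fE D : (\int[lebesgue_measure]_(t in D) f t =
    - \int[lebesgue_measure]_(t in D) (- f t))%E.
  by rewrite -integral_ge0N//; apply: eq_integral => x _; rewrite oppeK.
rewrite !fE => ->; rewrite oppeD// ge0_adde_def// inE; exact: integral_ge0.
Qed.

Section step_function.
Variables (R : realType) (W : R -> R -> R).

(** Blocks are closed on the right. Up to [a] the value is that of the first block and beyond the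
    last point it is 0; only []a, last a s]] matters for the integrals. *)
Fixpoint step (a : R) (s : seq R) (t : R) : R :=
  if s is x :: s' then if t <= x then W a x / (x - a) else step x s' t else 0.

Lemma measurable_step a s : measurable_fun [set: R] (step a s).
Proof.
elim: s a => [|x s IH] a /=; first exact: measurable_cst.
apply: measurable_fun_ifT => //; first exact: measurable_fun_ler.
Qed.

Hypothesis W0 : forall s t, s <= t -> 0 <= W s t.

Lemma step_ge0 a s t : path <%R a s -> 0 <= step a s t.
Proof.
elim: s a => [//|x s IH] a /= /andP[ax xs]; case: ifP => _; last exact: IH.
by rewrite divr_ge0 ?W0 ?subr_ge0 ?ltW.
Qed.

Lemma stepP a s t : a < t -> t <= last a s -> exists i : 'I_(size s),
  [/\ nth 0 (a :: s) i < t, t <= nth 0 (a :: s) i.+1 &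
  step a s t = W (nth 0 (a :: s) i) (nth 0 (a :: s) i.+1) /
     (nth 0 (a :: s) i.+1 - nth 0 (a :: s) i)].
Proof.
elim: s a => [|x s IH] a at_ /=; first by rewrite leNgt at_.
move=> tl; case: (leP t x) => [tx|xt]; first by exists ord0.
by have [i [h1 h2 h3]] := IH _ xt tl; exists (lift ord0 i).
Qed.

(** Used with G = u_q, where the sum is that of the block utilities, and with G the identity, where
    it is the total cost of the blocks. *)
Lemma integral_step (G : R -> \bar R) a s : measurable_fun [set: R] G ->
  ((forall z, 0 <= z -> (0 <= G z)%E) \/ (forall z, 0 <= z -> (G z <= 0)%E)) ->
  path <%R a s ->
  (\int[lebesgue_measure]_(t in `]a, (last a s)]) G (step a s t) =
   psum (fun b c => (c - b)%:E * G (W b c / (c - b))%R) a s)%E.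
Proof.
move=> mG sG; elim: s a => [|x s IH] a /=.
  by move=> _; rewrite psum_nil set_itv_ge ?integral_set0// bnd_simp ltxx.
move=> /andP[ax xs]; have xl : x <= last x s by apply: path_lt_le_last xs (mem_head _ _).
have axs : path <%R a (x :: s) by rewrite /= ax.
have -> : (fun t => G (if t <= x then W a x / (x - a) else step x s t)) =
    (fun t => G (step a (x :: s) t)) by [].
rewrite (@one_signed_integral_itv_setU _ _ a x)//; last 3 first.
- exact: (measurableT_comp mG (measurable_step a (x :: s))).
- by case: sG => h; [left|right] => t; apply: h; exact: step_ge0.
- exact: ltW.
rewrite psum_cons -IH//; congr (_ + _)%E.
  rewrite (eq_integral (cst (G (W a x / (x - a))))); last first.
    by move=> t; rewrite inE/= in_itv/= => /andP[_ ->].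
  rewrite integral_cst//=.
  by rewrite lebesgue_measure_itv/= lte_fin ax -EFinB muleC.
apply: eq_integral => t; rewrite inE/= in_itv/= => /andP[xt _].
by rewrite leNgt xt.
Qed.
End step_function.

Section utility_sum.
Variables (R : realType) (W : R -> R -> R) (M : R) (HW : interval_mass W M).
Variable q : R.
Hypotheses (q0 : q != 0) (q1 : q < 1).

Definition block_utility (a b : R) : \bar R :=
  ((b - a)%:E * u_ q (W a b / (b - a)))%E.
Local Notation phi := block_utility.

Lemma block_utility_le (z0 a b : R) : a < b -> 0 < z0 -> (phi a b <=
    ((b - a) * (z0 `^ q / q - z0 `^ (q - 1) * z0) + z0 `^ (q - 1) * W a b)%:E)%E.
Proof. by move=> ab z0p; apply: u_block; rewrite ?subr_gt0 ?(im_ge0 HW) ?ltW. Qed.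

Let phi0 a b : a < b -> W a b = 0 -> phi a b = ((b - a)%:E * u_ q 0)%E.
Proof. by move=> ab W0; rewrite /block_utility W0 mul0r. Qed.

Let phi_pos a b (z0 := W a b / (b - a)) : a < b -> 0 < z0 ->
  phi a b = ((b - a) * (z0 `^ q / q))%:E.
Proof. by move=> ab zp; rewrite /block_utility /u_ gt_eqF. Qed.

(** Both blocks are estimated by the tangent at the quotient z0 of the whole of ]a, c[. The bounds
    add up to [phi a c] plus a nonnegative slope times W(a, b) + W(b, c) - W(a, c) <= 0. If W(a, c)
    = 0, there is no tangent at z0 = 0, but then all three costs vanish. *)
Lemma block_utility_super a b c : a < b -> b < c -> (phi a b + phi b c <= phi a c)%E.
Proof.
move=> ab bc; have ac := lt_trans ab bc.
have Wab := im_ge0 HW (ltW ab); have Wbc := im_ge0 HW (ltW bc).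
have Wac := im_super HW (ltW ab) (ltW bc).
have [W0|Wn] := eqVneq (W a c) 0.
  have Wab0 : W a b = 0 by lra.
  have Wbc0 : W b c = 0 by lra.
  rewrite !phi0//.
  rewrite -ge0_muleDl ?lee_fin ?subr_ge0 ?(ltW ab) ?(ltW bc)//.
  by rewrite -EFinD (_ : b - a + (c - b) = c - a)//; ring.
have Wp : 0 < W a c by rewrite lt_neqAle eq_sym Wn; lra.
have zp : 0 < W a c / (c - a) by rewrite divr_gt0// subr_gt0.
rewrite (phi_pos ac zp).
apply: (le_trans (leeD (block_utility_le ab zp) (block_utility_le bc zp))).
rewrite -EFinD lee_fin; set z0 := _ / _ in zp *.
have z0E : W a c = z0 * (c - a) by rewrite divfK// gt_eqF// subr_gt0.
have : z0 `^ (q - 1) * (W a b + W b c - W a c) <= 0.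
  by apply: mulr_ge0_le0; [exact: powR_ge0|lra].
rewrite z0E; move: (z0 `^ (q - 1)) (z0 `^ q / q) => D L; nra.
Qed.

Lemma psum_mass_le a s : path <%R a s ->
  (psum (fun b c => (W b c)%:E) a s <= M%:E)%E.
Proof.
case: s => [|x s] axs.
  by rewrite psum_nil lee_fin; apply: (le_trans (im_ge0 HW (lexx 0)) (im_le HW (lexx 0))).
apply: le_trans (psum_le _ _ axs) _ => //.
  by move=> b c d bc cd; rewrite -EFinD lee_fin (im_super HW)// ltW.
rewrite lee_fin (im_le HW)//; exact: path_lt_le_last axs (mem_head _ _).
Qed.

Variables (rho : R -> R) (mus : borel_measure R).
Hypothesis dec : lebesgue_decomposition (mass HW) rho mus.
Let mrho : measurable_fun [set: R] rho. Proof. by case: dec. Qed.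
Let rho0 t : 0 <= rho t. Proof. by case: dec. Qed.

Let mu_rho : measurable_fun [set: R] (u_ q \o rho).
Proof. exact: measurableT_comp (measurable_u q) mrho. Qed.

(** Jensen's inequality through the tangent at W(a, b) / (b - a): its slope is nonnegative and the
    integral of [rho] is at most W(a, b). If W(a, b) = 0, then [rho] vanishes a.e. on the block. *)
Lemma integral_u_block a b : a < b ->
  (\int[lebesgue_measure]_(t in `]a, b]) u_ q (rho t) <= phi a b)%E.
Proof.
move=> ab.
have mI : measurable (`]a, b]%classic : set (measurableTypeR R)) by exact: measurable_itv.
have lI : (@lebesgue_measure R `]a, b] = (b - a)%:E)%E.
  by rewrite lebesgue_measure_itv/= lte_fin ab -EFinB.
have irho : (\int[lebesgue_measure]_(t in `]a, b]) (rho t)%:E <= (W a b)%:E)%E.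
  rewrite -integral_itv_bndo_bndc; last first.
    by apply/measurable_EFinP; exact: measurable_funTS.
  apply: le_trans (mass_itv HW ab).
  apply: (integral_density_le dec); exact: measurable_itv.
have [W0|Wn] := eqVneq (W a b) 0.
  rewrite phi0// -lI muleC -integral_cst//.
  rewrite le_eqVlt; apply/predU1P; left; apply: ae_eq_integral => //.
  - exact: measurable_funTS.
  have : ae_eq lebesgue_measure `]a, b]%classic (EFin \o rho) (cst 0%E).
    apply/ae_eq_integral_abs => //.
      by apply/measurable_EFinP; exact: measurable_funTS.
    under eq_integral do rewrite /= ger0_norm//.
    apply/eqP; rewrite W0 in irho; rewrite eq_le irho/=.
    by apply: integral_ge0 => t _; rewrite lee_fin.
  apply: filterS => t h It; have := h It; rewrite /= => -[->] //.
have Wp : 0 < W a b by rewrite lt_neqAle eq_sym Wn (im_ge0 HW)// ltW.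
have zp : 0 < W a b / (b - a) by rewrite divr_gt0// subr_gt0.
rewrite (phi_pos ab zp); set z0 := _ / _ in zp *.
have z0E : W a b = z0 * (b - a) by rewrite divfK// gt_eqF// subr_gt0.
have s0 : 0 <= z0 `^ (q - 1) by exact: powR_ge0.
apply: (@le_trans _ _ (\int[lebesgue_measure]_(t in `]a, b])
   ((z0 `^ q / q - z0 `^ (q - 1) * z0) + z0 `^ (q - 1) * rho t)%:E)%E).
  apply: le_integral_measurable => //.
  - exact: measurable_funTS.
  - apply/measurable_EFinP; apply: measurable_funTS.
    by apply: measurable_funD => //; apply: measurable_funM => //; exact: measurable_cst.
  move=> t _; apply: le_trans (u_tangent q0 q1 zp (rho0 t)) _.
  by rewrite lee_fin; lra.
have ir : lebesgue_measure.-integrable `]a, b]%classic (EFin \o rho).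
  exact: (integrable_density dec mI).
under eq_integral do rewrite EFinD.
rewrite integralD//; last 2 first.
- apply: (@measurable_bounded_integrable _ _ _ _ (cst (z0 `^ q / q - z0 `^ (q - 1) * z0))) => //=.
    by rewrite lI ltry.
  exact: bounded_cst.
- exact: (@integrableZl _ _ _ _ _ mI (z0 `^ (q - 1)) _ ir).
have -> : (\int[lebesgue_measure]_(t in `]a, b]) (z0 `^ q / q - z0 `^ (q - 1) * z0)%:E =
    (z0 `^ q / q - z0 `^ (q - 1) * z0)%:E * (b - a)%:E)%E.
  by rewrite -lI -integral_cst.
under eq_integral do rewrite EFinM.
rewrite integralZl//.
apply: (@le_trans _ _ (((z0 `^ q / q - z0 `^ (q - 1) * z0)%:E * (b - a)%:E) +
   (z0 `^ (q - 1))%:E * (W a b)%:E)%E).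
  by rewrite leeD2l// lee_wpmul2l// lee_fin.
rewrite -!EFinM -EFinD lee_fin z0E le_eqVlt; apply/orP; left; apply/eqP.
by move: (z0 `^ (q - 1)) (z0 `^ q / q) => D L; ring.
Qed.

Lemma integral_u_le_psum a s : path <%R a s ->
  (\int[lebesgue_measure]_(t in `]a, (last a s)]) u_ q (rho t) <= psum phi a s)%E.
Proof.
elim: s a => [|x s IH] a /=.
  by move=> _; rewrite psum_nil set_itv_ge ?integral_set0// bnd_simp ltxx.
move=> /andP[ax xs]; have xl : x <= last x s by apply: path_lt_le_last xs (mem_head _ _).
rewrite (@one_signed_integral_itv_setU _ _ a x)//; last 2 first.
- by case: (u_sign q) => h; [left|right] => t; apply: h; exact: rho0.
- exact: ltW.
by rewrite psum_cons; apply: leeD; [exact: integral_u_block|exact: IH].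
Qed.
End utility_sum.

(** * Convergence of the utility sums as the mesh vanishes *)

Lemma ereal_real_between (R : realType) (a b : \bar R) : (a < b)%E ->
  exists r : R, (a < r%:E)%E /\ (r%:E < b)%E.
Proof.
case: a b => [a| |] [b| |] //=; rewrite ?lte_fin ?ltry ?ltNyr//.
- by move=> ab; exists ((a + b) / 2); rewrite !lte_fin; split; lra.
- by move=> _; exists (a + 1); rewrite lte_fin ltry; split => //; lra.
- by move=> _; exists (b - 1); rewrite lte_fin ltNyr; split => //; lra.
- by move=> _; exists 0; rewrite ltry ltNyr.
Qed.

Lemma le_limn_einf (R : realType) (u : (\bar R)^nat) (l : \bar R) :
  (forall x : R, (x%:E < l)%E -> \forall k \near \oo, (x%:E <= u k)%E) ->
  (l <= limn_einf u)%E.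
Proof.
move=> H; rewrite limn_einf_lim leNgt; apply/negP.
rewrite (cvg_lim _ (@cvg_einfs_sup _ u))// => /ereal_real_between[x [supx xl]].
have [n _ hn] := H x xl.
suff : (x%:E <= ereal_sup (range (einfs u)))%E by rewrite leNgt supx.
apply: (@le_trans _ _ (einfs u n)); last by apply: ereal_sup_ubound; exists n.
by apply: le_ereal_inf_tmp => _ [k /= nk <-]; exact: hn.
Qed.

Lemma lt_limn_einf (R : realType) (u : (\bar R)^nat) (x : \bar R) :
  (x < limn_einf u)%E -> \forall k \near \oo, (x < u k)%E.
Proof.
rewrite limn_einf_lim (cvg_lim _ (@cvg_einfs_sup _ u))//.
move=> /ereal_sup_gt[_ [n _ <-]] xn; exists n => // k /= nk.
by apply: (lt_le_trans xn); apply: ereal_inf_lbound; exists k.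
Qed.

Lemma measurable_fun_limn_einf d (X : measurableType d) (R : realType) (D : set X)
    (f : (X -> \bar R)^nat) : (forall n, measurable_fun D (f n)) ->
  measurable_fun D (fun x => limn_einf (f ^~ x)).
Proof.
move=> mf; rewrite /limn_einf.
apply: (measurableT_comp (@oppe_measurable R setT)).
by apply: (measurable_fun_limn_esup (f := fun n x => - f n x)%E) => n;
  apply: (measurableT_comp (@oppe_measurable R setT)).
Qed.

Section utility_limit.
Variables (R : realType) (W : R -> R -> R) (M : R) (HW : interval_mass W M).
Variable q : R.
Hypotheses (q0 : q != 0) (q1 : q < 1).
Variables (rho : R -> R) (mus : borel_measure R).
Hypothesis dec : lebesgue_decomposition (mass HW) rho mus.
Let mrho : measurable_fun [set: R] rho. Proof. by case: dec. Qed.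
Let rho0 t : 0 <= rho t. Proof. by case: dec. Qed.
Local Notation phi := (block_utility W q).
Let D : set (measurableTypeR R) := `]0, 1]%classic.
Let mD : measurable D. Proof. exact: measurable_itv. Qed.
Let lD : @lebesgue_measure R D = 1%E.
Proof. by rewrite /D lebesgue_measure_itv/= lte_fin ltr01 -EFinB subr0. Qed.

Let u_pm := u_sign q.

(** The integral of u_q(tau) may be -oo, so linearity is proved by sign: if u_q >= 0, it is
    dominated by the integrable e tau + C; if u_q <= 0, a sum of nonnegative functions is
    integrated. The constant integrates to C because D has length 1. *)
Lemma integral_gap (e C : R) (tau : R -> R) : 0 < e -> 0 <= C ->
  (forall z, 0 <= z -> (u_ q z <= (e * z + C)%:E)%E) ->
  measurable_fun [set: R] tau -> (forall t, 0 <= t -> 0 <= tau t) ->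
  lebesgue_measure.-integrable D (EFin \o tau) ->
  (\int[lebesgue_measure]_(t in D) ((e * tau t + C)%:E - u_ q (tau t)) =
   (e%:E * \int[lebesgue_measure]_(t in D) (tau t)%:E + C%:E) -
   \int[lebesgue_measure]_(t in D) u_ q (tau t))%E.
Proof.
move=> e0 C0 uC mtau tau0 itau.
have Dt t : D t -> 0 <= tau t by rewrite /D/= in_itv/= => /andP[/ltW + _]; exact: tau0.
have mg : measurable_fun D (fun t => (e * tau t + C)%:E).
  apply/measurable_EFinP; apply: measurable_funTS.
  by apply: measurable_funD => //; apply: measurable_funM => //; exact: measurable_cst.
have mu : measurable_fun D (fun t => u_ q (tau t)).
  by apply: measurable_funTS; exact: (measurableT_comp (measurable_u q) mtau).
have iC : lebesgue_measure.-integrable D (EFin \o cst C).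
  apply: measurable_bounded_integrable => //=; first by rewrite lD ltry.
  exact: bounded_cst.
have ie : lebesgue_measure.-integrable D (fun t => e%:E * (EFin \o tau) t)%E.
  exact: integrableZl.
have ig : lebesgue_measure.-integrable D (fun t => (e * tau t + C)%:E).
  exact: (integrableD mD ie iC).
have <- : (\int[lebesgue_measure]_(t in D) (e * tau t + C)%:E =
    e%:E * \int[lebesgue_measure]_(t in D) (tau t)%:E + C%:E)%E.
  rewrite -(integralZl mD itau).
  have <- : (\int[lebesgue_measure]_(t in D) (EFin \o cst C) t = C%:E)%E.
    by rewrite -[RHS]mule1 -lD -integral_cst.
  by rewrite -integralD.
case: u_pm => hu.
  rewrite integralB//.
  apply: le_integrable ig => // t tD; rewrite !gee0_abs ?hu ?uC ?Dt//.
  by rewrite lee_fin addr_ge0 ?mulr_ge0 ?Dt// ltW.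
rewrite ge0_integralD//; last 3 first.
- by move=> t tD; rewrite lee_fin addr_ge0 ?mulr_ge0 ?Dt// ltW.
- by move=> t tD; rewrite oppe_ge0 hu ?Dt.
- exact: (measurableT_comp (@oppe_measurable R setT)).
congr (_ + _)%E.
rewrite -[LHS]oppeK -integral_ge0N; last by move=> t tD; rewrite oppe_ge0 hu ?Dt.
by congr oppe; apply: eq_integral => t _; rewrite oppeK.
Qed.

Variable P : nat -> seq R.
Hypothesis pathP_ : forall k, path <%R 0 (P k).
Hypothesis lastP_ : forall k, last 0 (P k) = 1.
Hypothesis meshP : forall e, 0 < e -> \forall k \near \oo,
  forall i : 'I_(size (P k)),
    nth 0 (0 :: P k) i.+1 - nth 0 (0 :: P k) i <= e.

Let W0 := im_ge0 HW.
Let tau k := step W 0 (P k).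
Let I := (\int[lebesgue_measure]_(t in D) u_ q (rho t))%E.
Let A k := psum phi 0 (P k).

Let AE k : A k = (\int[lebesgue_measure]_(t in D) u_ q (tau k t))%E.
Proof.
have := integral_step W0 (measurable_u q) u_pm (pathP_ k).
by rewrite lastP_ => ->.
Qed.

Let tauM k : (\int[lebesgue_measure]_(t in D) (tau k t)%:E <= M%:E)%E.
Proof.
have := @integral_step _ _ W0 EFin 0 (P k) _ _ (pathP_ k).
rewrite lastP_ => -> //; last by left => z.
apply: le_trans (psum_mass_le HW (pathP_ k)).
rewrite le_eqVlt; apply/predU1P; left; rewrite /psum; apply: eq_bigr => i _.
rewrite -EFinM; congr EFin; rewrite mulrC divfK// gt_eqF// subr_gt0.
by have /(pathP 0) := pathP_ k; apply.
Qed.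

Let tau0 k t : 0 <= tau k t. Proof. exact: step_ge0. Qed.
Let mtau k : measurable_fun [set: R] (tau k). Proof. exact: measurable_step. Qed.

Let itau k : lebesgue_measure.-integrable D (EFin \o tau k).
Proof.
apply/integrableP; split; first by apply/measurable_EFinP; exact: measurable_funTS (mtau k).
under eq_integral do rewrite /= ger0_norm//.
by apply: le_lt_trans (tauM k) _; rewrite ltry.
Qed.

(** At t the step function is the quotient over the block containing t, which is as short as the
    mesh, so [density_limit] applies. *)
Let tau_cvg : {ae @lebesgue_measure R, forall t, D t -> forall e, 0 < e ->
  \forall k \near \oo, `|tau k t - rho t| <= e}.
Proof.
have FF := ae_filter_ringOfSetsType (@lebesgue_measure R).
apply: (@filterS _ _ FF _ _ _ (density_limit dec)) => t Ht tD e e0.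
have [d d0 hd] := Ht e e0.
have d20 : 0 < d / 2 by rewrite divr_gt0.
apply: filterS (meshP d20) => k mk.
have [t0 t1] : 0 < t /\ t <= last 0 (P k).
  by rewrite lastP_; move: tD; rewrite /D/= in_itv/= => /andP[].
have [i [rt ts tE]] := stepP W t0 t1; rewrite /tau tE.
have := mk i; set r := nth 0 _ _ in rt *; set s := nth 0 _ _ in ts * => rs2.
have rs : r < s by exact: lt_le_trans rt ts.
have sr0 : 0 < s - r by rewrite subr_gt0.
have := hd r s rs; rewrite (ltW rt) ts => /(_ isT).
have -> : t - d < r by lra.
have -> : s < t + d by lra.
move=> /(_ isT isT) h.
have -> : W r s / (s - r) - rho t = (W r s - rho t * (s - r)) / (s - r).
  by rewrite mulrBl mulfK// gt_eqF.
by rewrite normrM normfV (gtr0_norm sr0) ler_pdivrMr.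
Qed.

(** Fatou gives C - y' < e * (integral of tau_k) + C - A_k for all large k. As the integral of tau_k
    is at most M, this yields A_k < y' + e M <= y by the choice of e; M + 1 in its denominator
    allows for M = 0. *)
Lemma psum_utility_ub (y : R) : (I < y%:E)%E -> \forall k \near \oo, (A k <= y%:E)%E.
Proof.
move=> /ereal_real_between[y' [Iy' y'y]]; rewrite lte_fin in y'y.
have M0 : 0 <= M by apply: (le_trans (W0 (lexx 0))); exact: (im_le HW (lexx 0)).
pose e := (y - y') / (M + 1).
have e0 : 0 < e by rewrite divr_gt0 ?subr_gt0//; lra.
have eM : e * M <= y - y'.
  have : e * (M + 1) = y - y' by rewrite divfK// gt_eqF//; lra.
  nra.
have [C C0 uC] := u_majorant q0 q1 e0.
pose f k t := ((e * tau k t + C)%:E - u_ q (tau k t))%E.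
pose g t := ((e * rho t + C)%:E - u_ q (rho t))%E.
have fgge0 z : 0 <= z -> (0 <= (e * z + C)%:E - u_ q z)%E.
  move=> z0; have := uC z z0; case: (u_ q z) => [r|//|_]; last exact: leey.
  by rewrite -EFinB !lee_fin subr_ge0.
have mfg (s : R -> R) : measurable_fun [set: R] s ->
    measurable_fun [set: R] (fun t => (e * s t + C)%:E - u_ q (s t))%E.
  move=> ms; apply: emeasurable_funB.
    apply/measurable_EFinP.
    by apply: measurable_funD => //; apply: measurable_funM => //; exact: measurable_cst.
  exact: (measurableT_comp (measurable_u q) ms).
(* Fatou needs only this lower bound, for which upper semicontinuity of u_q suffices; at [rho t = 0]
   and q < 0, g is +oo. *)
have key : {ae @lebesgue_measure R, forall t, D t -> (g t <= limn_einf (f ^~ t))%E}.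
  have FF := ae_filter_ringOfSetsType (@lebesgue_measure R).
  apply: (@filterS _ _ FF _ _ _ tau_cvg) => t Ht tD.
  apply: le_limn_einf => x xg.
  have uy0 : (u_ q (rho t) < (e * rho t + C - x)%:E)%E.
    move: xg; rewrite /g; case: (u_ q (rho t)) => [r|//|_]; last exact: ltNyr.
    by rewrite -EFinB !lte_fin; lra.
  have [y1 [uy1 y1y0]] := ereal_real_between uy0; rewrite lte_fin in y1y0.
  have [d d0 hd] := u_usc q0 q1 (rho0 t) uy1.
  (* The first bound keeps u_q(tau_k) below y1, the second keeps e tau_k + C above x + y1. *)
  pose d' := Num.min d ((e * rho t + C - x - y1) / e).
  have d'0 : 0 < d' by rewrite lt_min d0 divr_gt0// subr_gt0.
  apply: filterS (Ht tD d' d'0) => k hk.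
  have dd : d' <= d by rewrite ge_min lexx.
  have de : d' <= (e * rho t + C - x - y1) / e by rewrite ge_min lexx orbT.
  have uk := hd _ (tau0 k t) (le_trans hk dd).
  have h2 : `|tau k t - rho t| * e <= e * rho t + C - x - y1.
    by rewrite -ler_pdivlMr//; exact: le_trans hk de.
  have h3 : (rho t - tau k t) * e <= `|tau k t - rho t| * e.
    by apply: ler_wpM2r; [exact: ltW|rewrite distrC ler_norm].
  apply: (@le_trans _ _ ((e * tau k t + C)%:E - y1%:E)%E); last by rewrite leeB.
  by rewrite -EFinB lee_fin; nra.
have fatou_ : (\int[lebesgue_measure]_(t in D) g t <=
    limn_einf (fun k => \int[lebesgue_measure]_(t in D) f k t))%E.
  apply: (@le_trans _ _ (\int[lebesgue_measure]_(t in D) limn_einf (f ^~ t))%E).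
    apply: ae_ge0_le_integral => //.
    - by move=> t _; exact: fgge0.
    - by apply: measurable_funTS; exact: mfg.
    - by move=> t _; apply: le_limn_einf => x x0; apply: nearW => k;
        apply: (le_trans (ltW x0)); exact: fgge0.
    - by apply: measurable_fun_limn_einf => k; apply: measurable_funTS; exact: mfg.
  apply: fatou => // k; first by apply: measurable_funTS; exact: mfg.
  by move=> t _; exact: fgge0.
have : ((C - y')%:E < limn_einf (fun k => \int[lebesgue_measure]_(t in D) f k t))%E.
  apply: lt_le_trans fatou_; rewrite /g integral_gap//; last exact: (integrable_density dec mD).
  apply: (@lt_le_trans _ _ (C%:E - I)%E).
    by move: Iy'; case: I => [i|//|_]; [rewrite -EFinB !lte_fin; lra|exact: ltry].
  apply: leeB => //; rewrite leeDr// mule_ge0 ?lee_fin ?(ltW e0)//.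
  by apply: integral_ge0 => t _; rewrite lee_fin.
move=> /lt_limn_einf; apply: filterS => k; rewrite /f integral_gap// -AE => h.
have := itau k => /(integrable_fin_num mD) fin1.
have : (\int[lebesgue_measure]_(t in D) (tau k t)%:E <= M%:E)%E by exact: tauM.
move: fin1 h; rewrite /comp; case: (\int[_]_(_ in _) (tau k _)%:E)%E => //= r _.
case: (A k) => [a|//|_ _]; last by rewrite leNye.
rewrite -!EFinM -!EFinD -?EFinB lte_fin !lee_fin.
move=> h rM; have : e * r <= e * M by rewrite ler_pM2l.
lra.
Qed.

Lemma psum_utility_cvg : A k @[k --> \oo] --> I.
Proof.
have IA k : (I <= A k)%E.
  by have := integral_u_le_psum q0 q1 dec (pathP_ k); rewrite lastP_.
have ub := psum_utility_ub.
case: I IA ub => [i| |] IA ub.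
- apply/fine_cvgP; split.
    have : (i%:E < (i + 1)%:E)%E by rewrite lte_fin ltrDl.
    move=> /ub; apply: filterS => k ki; rewrite fin_numElt.
    apply/andP; split; first exact: lt_le_trans (ltNyr _) (IA k).
    exact: le_lt_trans ki (ltry _).
  apply/cvgrPdist_le => e e0.
  have : (i%:E < (i + e)%:E)%E by rewrite lte_fin ltrDl.
  move=> /ub; apply: filterS => k; move: (IA k) => /=.
  case: (A k) => [a| |]//=; rewrite !lee_fin => h1 h2.
  by rewrite ler0_norm; lra.
- by apply: cvg_near_cst; apply: nearW => k; apply/eqP; rewrite -leye_eq IA.
- by apply/cvgeNyPle => y; apply: ub; rewrite ltNyr.
Qed.
End utility_limit.

(** * Lebesgue decomposition and lower integrals *)

(** N is a Lebesgue-null set of largest mu-mass S, obtained as the union of a maximizing sequence.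
    Off N the measure is absolutely continuous, since a null set charged outside N would raise the
    mass of N above S; Radon-Nikodym applies there, and the restriction to N is the singular
    part. *)
Lemma lebesgue_decomposition_exists (R : realType) (mu : borel_measure R) :
  (mu setT < +oo)%E ->
  exists (rho : R -> R) (mus : borel_measure R), lebesgue_decomposition mu rho mus.
Proof.
move=> muoo; pose X := measurableTypeR R.
have mufin (B : set X) : measurable B -> mu B \is a fin_num.
  move=> mB; rewrite ge0_fin_numE//; apply: le_lt_trans muoo.
  by apply: le_measure; rewrite ?inE.
pose S := ereal_sup [set mu B | B in
  [set B : set X | measurable B /\ @lebesgue_measure R B = 0%E]].
have Sle : (S <= mu setT)%E.
  by apply: ge_ereal_sup => _ [B [mB _] <-]; apply: le_measure; rewrite ?inE.
have S0 : (0 <= S)%E.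
  by apply: ereal_sup_ubound; exists set0; [split; rewrite ?measure0|rewrite measure0].
have Sfin : S \is a fin_num by rewrite ge0_fin_numE// (le_lt_trans Sle).
have /choice[B hB] : forall n : nat, exists B : set X,
    [/\ measurable B, @lebesgue_measure R B = 0%E &
        (S - (n.+1%:R^-1 : R)%:E < mu B)%E].
  move=> n; have n0 : 0 < n.+1%:R^-1 :> R by rewrite invr_gt0.
  by have [_ [B [mB B0] <-] h] := ub_ereal_sup_adherent n0 Sfin; exists B.
pose N := \bigcup_n B n.
have mN : measurable N by apply: bigcupT_measurable => n; have [] := hB n.
have N0 : @lebesgue_measure R N = 0%E.
  apply/negligibleP => //; apply: negligible_bigcup => n.
  by apply/negligibleP; have [] := hB n.
have NS : (S <= mu N)%E.
  apply/lee_addgt0Pr => e e0; near \oo => n; have [mBn _ hn] := hB n.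
  have ne : n.+1%:R^-1 < e by near: n; exact: (near_infty_natSinv_lt (PosNum e0)).
  have : (mu (B n) <= mu N)%E.
    by apply: le_measure; rewrite ?inE//; exact: bigcup_sup.
  move=> /(lt_le_trans hn); rewrite lteBlDr// => /ltW /le_trans; apply.
  by rewrite leeD2l// lee_fin ltW.
have mNC : measurable (~` N) by exact: measurableC.
have NCoo : (mu (~` N) < +oo)%E by rewrite -ge0_fin_numE// mufin.
pose nu : {finite_measure set X -> \bar R} := mfrestr mNC NCoo.
have nuE A : nu A = mu (A `\` N) by rewrite /nu/= /mfrestr /mrestr setDE.
have nudom : nu `<< @lebesgue_measure R.
  apply/null_content_dominatesP => A mA A0.
  rewrite nuE; have mAN : measurable (A `\` N) by exact: measurableD.
  have h : (mu (N `|` A `\` N) <= mu N)%E.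
    apply: le_trans NS; apply: ereal_sup_ubound; exists (N `|` A `\` N) => //.
    split; first exact: measurableU.
    apply/eqP; rewrite eq_le measure_ge0 andbT.
    have AN : (@lebesgue_measure R (A `\` N) <= @lebesgue_measure R A)%E.
      by apply: le_measure; rewrite ?inE//; exact: subDsetl.
    rewrite -[leRHS]adde0; apply: le_trans (measureU2 _ mN mAN) _.
    by apply: leeD; [rewrite -N0|rewrite -A0].
  rewrite measureU// in h; last by rewrite setIDA setIC -setIDA setDv setI0.
  apply/eqP; rewrite eq_le measure_ge0 andbT.
  by rewrite -(leeD2lE _ _ (mufin _ mN)) adde0.
have [f [f0 ffin intf fE]] := radon_nikodym_sigma_finite nudom.
have fineE : EFin \o (fine \o f) = f by apply/funext => x /=; rewrite fineK.
have mf : measurable_fun [set: X] f by exact: measurable_int intf.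
exists (fine \o f), (mrestr mu mN); split.
- by apply/measurable_EFinP; rewrite fineE.
- by move=> t; exact: fine_ge0.
- by exists N; split => //; rewrite /= /mrestr setICl measure0.
- move=> A mA.
  have -> : (\int[lebesgue_measure]_(t in A) ((fine \o f) t)%:E)%E = nu A.
    by rewrite fE//; apply: eq_integral => x _; rewrite /= fineK.
  by rewrite nuE /= /mrestr; exact: measureDI.
Unshelve. all: by end_near. Qed.

Section measurable_minorant.
Variables (R : realType) (g : R -> \bar R).
Hypothesis g0 : forall t, (0 <= g t)%E.
Local Open Scope ereal_scope.
Let X := measurableTypeR R.
Let la := @lebesgue_measure R.
Import HBNNSimple.

(** A simple function below f1 is below f2, so the suprema that define the two integrals compare. *)
Lemma ge0_le_integral_nonmeasurable (f1 f2 : R -> \bar R) (B : set X) :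
  (forall t, 0 <= f1 t) -> (forall t, f1 t <= f2 t) ->
  \int[la]_(t in B) f1 t <= \int[la]_(t in B) f2 t.
Proof.
move=> f10 f12; have f20 t : 0 <= f2 t by exact: le_trans (f10 t) (f12 t).
rewrite !ge0_integralE //=; apply: ereal_sup_le => _ [h /= hf <-]; exists h => //= x.
apply: le_trans (hf x) _; rewrite /patch; case: ifP => // _; exact: f12.
Qed.

(* g need not be measurable: its integral is a lower integral, and f is the
   supremum of a maximizing sequence of simple functions below g. If f were not
   optimal on some B, its maximum with a better simple function would beat the
   sequence. *)
Lemma measurable_minorant : \int[la]_t g t < +oo ->
  exists f : R -> \bar R, [/\ measurable_fun [set: X] f, forall t, 0 <= f t,
    forall t, f t <= g t &
    forall B : set X, measurable B -> \int[la]_(t in B) g t = \int[la]_(t in B) f t].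
Proof.
move=> goo.
have gfin : \int[la]_t g t \is a fin_num by rewrite ge0_fin_numE// integral_ge0.
have approx (B : set X) (x : \bar R) : x < \int[la]_(t in B) g t ->
    exists s : {nnsfun X >-> R}, (forall t, (s t)%:E <= (g \_ B) t) /\
      x < \int[la]_t (s t)%:E.
  rewrite ge0_integralE//= => /ereal_sup_gt[_ [s sg <-] xs].
  by exists s; split => //; rewrite integralT_nnsfun.
have /choice[s hs] : forall n : nat, exists s : {nnsfun X >-> R},
    (forall t, (s t)%:E <= g t) /\
      \int[la]_t g t - (n.+1%:R^-1 : R)%:E < \int[la]_t (s t)%:E.
  move=> n; have [|s [sg hs]] := @approx setT (\int[la]_t g t - (n.+1%:R^-1 : R)%:E).
    by rewrite lteBlDr// lteDl// lte_fin invr_gt0.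
  by exists s; split => // t; have := sg t; rewrite patch_setT.
pose f t := esups (fun n => (s n t)%:E) 0%N.
have mf : measurable_fun [set: X] f.
  by apply: measurable_fun_esups => n; apply/measurable_EFinP.
have sf n t : (s n t)%:E <= f t by apply: ereal_sup_ubound; exists n.
have f0 t : 0 <= f t by apply: le_trans (sf 0%N t); rewrite lee_fin.
have fg t : f t <= g t by apply: ge_ereal_sup => _ [n _ <-]; have [] := hs n.
have fT : \int[la]_t f t = \int[la]_t g t.
  apply/eqP; rewrite eq_le ge0_le_integral_nonmeasurable//=.
  apply/lee_addgt0Pr => e e0; near \oo => n; have [_ hn] := hs n.
  have ne : (n.+1%:R^-1 < e)%R by near: n; exact: (near_infty_natSinv_lt (PosNum e0)).
  rewrite -leeBlDr//; apply: (@le_trans _ _ (\int[la]_t (s n t)%:E)).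
    by apply: le_trans (ltW hn); rewrite leeB// lee_fin ltW.
  by apply: ge0_le_integral_nonmeasurable => // t; rewrite lee_fin.
exists f; split => // B mB; apply/eqP; rewrite eq_le.
rewrite [X in _ && X]ge0_le_integral_nonmeasurable// andbT leNgt; apply/negP.
move=> /approx[r [rg fr]].
pose F t := maxe (f t) (r t)%:E.
have mF : measurable_fun [set: X] F.
  by apply: measurable_maxe => //; apply/measurable_EFinP.
have F0 t : 0 <= F t by rewrite /F le_max f0.
have Fg t : F t <= g t.
  rewrite /F ge_max fg/=; apply: le_trans (rg t) _.
  by rewrite /patch; case: ifP.
have rB t : ~ B t -> r t = 0%R.
  move=> Bt; apply/eqP; rewrite eq_le; apply/andP; split => //.
  by have := rg t; rewrite /patch memNset// lee_fin.
have : \int[la]_t F t <= \int[la]_t f t.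
  by rewrite fT; exact: ge0_le_integral_nonmeasurable.
have mBC : measurable (~` B) by exact: measurableC.
have split_ (k : R -> \bar R) : measurable_fun [set: X] k -> (forall t, 0 <= k t) ->
    \int[la]_t k t = \int[la]_(t in B) k t + \int[la]_(t in ~` B) k t.
  move=> mk k0; rewrite -[in LHS](setUv B) ge0_integral_setU//.
    by rewrite setUv.
  by rewrite disj_set2E setICr.
apply/negP; rewrite -ltNge (split_ F)// (split_ f)//.
apply: lte_leD.
- rewrite ge0_fin_numE ?integral_ge0//.
  apply: (@le_lt_trans _ _ (\int[la]_t f t)); last by rewrite fT.
  exact: ge0_subset_integral.
- apply: (lt_le_trans fr).
  rewrite (_ : \int[la]_t (r t)%:E = \int[la]_(t in B) (r t)%:E).
    by apply: ge0_le_integral_nonmeasurable => t; rewrite ?lee_fin// /F le_max lexx orbT.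
  rewrite [RHS]integral_mkcond; apply: eq_integral => t _.
  by rewrite /patch; case: ifPn => // /negP; rewrite inE => /rB ->.
- by apply: ge0_le_integral_nonmeasurable => // t; rewrite /F le_max lexx.
Unshelve. all: by end_near. Qed.
End measurable_minorant.

(** Lebesgue measure equals its image under translation because the two agree on half-open
    intervals; the rest is change of variables. *)
Lemma ge0_integral_translate (R : realType) (F : R -> \bar R) (a b h : R) :
  measurable_fun [set: R] F -> (forall t, 0 <= F t)%E ->
  (\int[lebesgue_measure]_(t in `]a, b[) F (t + h)%R =
   \int[lebesgue_measure]_(t in `](a + h)%R, (b + h)%R[) F t)%E.
Proof.
move=> mF F0; pose tr0 : R -> R := fun t => t + h.
pose tr : measurableTypeR R -> measurableTypeR R := tr0.
have mtr : measurable_fun setT tr.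
  have : measurable_fun [set: R] tr0 by apply: measurable_funD => //; exact: measurable_cst.
  by [].
have trE : forall A, measurable A -> @lebesgue_measure R A =
    pushforward (@lebesgue_measure R) tr A.
  apply: lebesgue_measure_unique => _ [[x y]] _ <-; rewrite /pushforward.
  rewrite [X in _ = lebesgue_measure X](_ : _ = `](x - h), (y - h)]%classic).
    rewrite !lebesgue_measure_itv/= !lte_fin ltrD2r; case: ifP => // _.
    by rewrite -!EFinB; congr EFin; ring.
  by apply/seteqP; split => t; rewrite /= !in_itv/= /tr /tr0 ltrBlDr lerBrDr.
transitivity (\int[pushforward (@lebesgue_measure R) tr]_(t in `](a + h)%R, (b + h)%R[) F t)%E.
  rewrite (ge0_integral_pushforward mtr)//; last exact: measurable_funTS.
  rewrite [X in _ = integral _ X _](_ : _ = `]a, b[%classic)//.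
  by apply/seteqP; split => t; rewrite /= !in_itv/= /tr /tr0 !ltrD2r.
by apply: eq_measure_integral => A mA _; exact/esym/trE.
Qed.

Section density_lower_bound.
Variables (R : realType) (m : borel_measure R) (k : R -> R).
Hypotheses (mk : measurable_fun [set: R] k) (k0 : forall t, 0 <= k t).
Local Open Scope ereal_scope.
Let X := measurableTypeR R.
Let la := @lebesgue_measure R.
Hypothesis km : forall B : set X, measurable B -> \int[la]_(t in B) (k t)%:E <= m B.
Import HBNNSimple.

Let density_nnsfun (s : {nnsfun X >-> R}) :
  \int[la]_t ((s t)%:E * (k t)%:E) <= \int[m]_t (s t)%:E.
Proof.
rewrite integralT_nnsfun sintegralE.
have -> : \int[la]_t ((s t)%:E * (k t)%:E) =
    \int[la]_t (\sum_(y \in range s) (y * \1_(s @^-1` [set y]) t)%:E * (k t)%:E).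
  apply: eq_integral => t _.
  rewrite {1}(fimfunE s) -fsumEFin// ge0_mule_fsuml// => y.
  exact: nnfun_muleindic_ge0.
rewrite ge0_integral_fsum//; last 2 first.
- move=> y; apply: emeasurable_funM; last exact/measurable_EFinP.
  by apply/measurable_EFinP; exact: measurable_funM.
- by move=> y t _; apply: mule_ge0; [exact: nnfun_muleindic_ge0|rewrite lee_fin].
apply: lee_fsum => // y [t _ yE].
have y0 : (0 <= y)%R by rewrite -yE.
under eq_integral do rewrite EFinM -muleA.
have mi : measurable_fun [set: X] (fun t => (\1_(s @^-1` [set y]) t)%:E * (k t)%:E).
  by apply: emeasurable_funM; apply/measurable_EFinP => //; exact: measurable_indic.
have i0 (x : X) : 0 <= (\1_(s @^-1` [set y]) x)%:E * (k x)%:E.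
  by rewrite mule_ge0// lee_fin.
rewrite ge0_integralZl//.
apply: lee_wpmul2l; first by rewrite lee_fin.
have mS : measurable (s @^-1` [set y]) by [].
apply: le_trans (km mS).
rewrite le_eqVlt [X in _ == X]integral_mkcond; apply/orP; left; apply/eqP.
apply: eq_integral => x _; rewrite /patch indicE; case: ifPn => _.
  by rewrite mul1e.
by rewrite mul0e.
Qed.

(** [density_nnsfun] treats simple functions, level set by level set; monotone limits do the
    rest. *)
Lemma integral_density_lower (phi : R -> \bar R) :
  measurable_fun [set: R] phi -> (forall t, 0 <= phi t) ->
  \int[la]_t (phi t * (k t)%:E) <= \int[m]_t phi t.
Proof.
move=> mphi phi0; have mphi' : measurable_fun [set: X] (phi : X -> \bar R) by [].
pose h := nnsfun_approx (@measurableT _ X) mphi'.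
have hphi x : (h n x)%:E @[n --> \oo] --> phi x by exact: cvg_nnsfun_approx.
have -> : \int[la]_t (phi t * (k t)%:E) =
    limn (fun n => \int[la]_t ((h n t)%:E * (k t)%:E)).
  rewrite -monotone_convergence//.
  - apply: eq_integral => x _; apply/esym/cvg_lim => //.
    by apply: cvgeZr => //; exact: hphi.
  - move=> n; apply: emeasurable_funM; exact/measurable_EFinP.
  - by move=> n x _; rewrite mule_ge0 ?lee_fin.
  - move=> x _ a b ab; rewrite lee_wpmul2r ?lee_fin//.
    exact/lefP/nd_nnsfun_approx.
apply: lime_le.
  apply: ereal_nondecreasing_is_cvgn => a b ab; apply: ge0_le_integral => //.
  - by move=> x _; rewrite mule_ge0 ?lee_fin.
  - by apply: emeasurable_funM; exact/measurable_EFinP.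
  - by apply: emeasurable_funM; exact/measurable_EFinP.
  - move=> x _; rewrite lee_wpmul2r ?lee_fin//.
    exact/lefP/nd_nnsfun_approx.
apply: nearW => n; apply: le_trans (density_nnsfun (h n)) _.
apply: ge0_le_integral => //.
- by move=> x _; rewrite lee_fin.
- exact/measurable_EFinP.
- move=> x _; have hcv := hphi x; rewrite -(cvg_lim _ hcv)//.
  have nd : nondecreasing_seq (fun n => (h n x)%:E).
    by move=> a b ab; rewrite lee_fin; exact/lefP/nd_nnsfun_approx.
  rewrite (cvg_lim _ (ereal_nondecreasing_cvgn nd))//.
  by apply: ereal_sup_ubound; exists n.
Qed.
End density_lower_bound.

(** * Weak convergence of the difference quotients *)

Section difference_quotient_measures.
Variables (R : realType) (W : R -> R -> R) (M : R) (HW : interval_mass W M).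
Let X := measurableTypeR R.
Let la : {measure set X -> \bar R} := @lebesgue_measure R.

Let mass_oo : (mass HW setT < +oo)%E.
Proof. by apply: le_lt_trans (mass_fin HW) _; rewrite ltry. Qed.

(** The measure [mass HW] again, packed as a finite measure for Tonelli's theorem. *)
Let mu : {finite_measure set X -> \bar R} := mfrestr measurableT mass_oo.

Let muE A : mu A = mass HW A.
Proof. by rewrite /mu/= /mfrestr /mrestr setIT. Qed.

(** The quotient is at most M / h and vanishes off [-h, 1], so its lower integral is finite and
    [measurable_minorant] applies. *)
Lemma quotient_minorant h : 0 < h -> exists f : R -> \bar R,
  [/\ measurable_fun [set: X] f, forall t, (0 <= f t)%E,
    forall t, (f t <= (W t (t + h) / h)%:E)%E &
    forall B : set X, measurable B ->
      (\int[la]_(t in B) (W t (t + h) / h)%:E = \int[la]_(t in B) f t)%E].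
Proof.
move=> h0; have g0 t : (0 <= (W t (t + h) / h)%:E)%E.
  by rewrite lee_fin divr_ge0 ?(im_ge0 HW) ?ltW// ltrDl.
apply: (measurable_minorant g0).
pose K : set X := `[- h, 1]%classic.
have mK : measurable K by exact: measurable_itv.
apply: (@le_lt_trans _ _ (\int[la]_(t in K) (M / h)%:E)%E).
  rewrite [leRHS]integral_mkcond.
  apply: ge0_le_integral_nonmeasurable => // t.
  rewrite /patch; case: ifPn => [_|].
    by rewrite lee_fin ler_pM2r ?invr_gt0// (im_le HW)// ltW// ltrDl.
  move=> /negP; rewrite inE /K/= in_itv/= => /negP; rewrite negb_and -!ltNge => tK.
  rewrite (im_supp HW) ?mul0r//; first by rewrite ltW// ltrDl.
  by case/orP: tK => tK; [left; lra|right; lra].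
rewrite integral_cst//.
have -> : (la K = (1 - (- h))%:E)%E.
  by apply: (etrans (@lebesgue_measure_itv R `[- h, 1])); rewrite /= lte_fin ifT//; lra.
by rewrite -EFinM ltry.
Qed.

(* Tonelli: int_t g(t) mu(]t, t + h[) dt = int_x (int_(]x - h, x[) g) dmu(x). *)
Lemma integral_mass_le (m : borel_measure R) (h e : R) (g : R -> R) : 0 < h -> 0 <= e ->
  (forall B : set X, measurable B ->
    (\int[la]_(t in B) (W t (t + h) / h)%:E <= m B)%E) ->
  measurable_fun [set: R] g -> (forall t, 0 <= g t) ->
  (forall t x, `|t - x| <= h -> g x <= g t + e) ->
  (\int[mass HW]_x (g x)%:E <= \int[m]_x (g x)%:E + (e * M)%:E)%E.
Proof.
rewrite (@eq_measure_integral _ _ _ _ mu); last by move=> A _ _; rewrite -muE.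
move=> h0 e0 Wm mg g0 gu.
pose F (tx : X * X) : \bar R :=
  (if (tx.1 < tx.2) && (tx.2 < tx.1 + h) then g tx.1 else 0)%:E.
pose F1 (tx : X * X) : \bar R :=
  (if (tx.1 < tx.2) && (tx.2 < tx.1 + h) then 1 else 0)%:E.
have mfst : measurable_fun [set: X * X] (fun tx : X * X => tx.1 : R) by exact: measurable_fst.
have msnd : measurable_fun [set: X * X] (fun tx : X * X => tx.2 : R) by exact: measurable_snd.
have mcond : measurable_fun [set: X * X]
    (fun tx : X * X => ((tx.1 : R) < tx.2) && ((tx.2 : R) < (tx.1 : R) + h)).
  apply: measurable_and; apply: measurable_fun_ltr => //.
  by apply: measurable_funD => //; exact: measurable_cst.
have mF : measurable_fun [set: X * X] F.
  apply/measurable_EFinP; apply: measurable_fun_ifT => //.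
  exact: (measurableT_comp mg mfst).
have mF1 : measurable_fun [set: X * X] F1.
  by apply/measurable_EFinP; apply: measurable_fun_ifT.
have F0 tx : (0 <= F tx)%E by rewrite /F lee_fin; case: ifP.
have F10 tx : (0 <= F1 tx)%E by rewrite /F1 lee_fin; case: ifP.
(* A density below W(t, t + h) / h that is measurable in t, being h^-1 times a partial integral of
   F1. *)
pose k t : R := fine (mu `]t, (t + h)%R[%classic) / h.
have int1 t : (\int[mu]_x F1 (t, x) = mu `]t, (t + h)%R[%classic)%E.
  rewrite -[mu _]mul1e -integral_cst; last exact: measurable_itv.
  rewrite [RHS]integral_mkcond; apply: eq_integral => x _.
  rewrite /F1 /patch/= mem_setE in_itv/=.
  by case: ifP.
have mufin (t : R) : mu `]t, (t + h)%R[%classic \is a fin_num.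
  by apply: fin_num_measure; exact: measurable_itv.
have mk : measurable_fun [set: R] k.
  apply: measurable_funM; last exact: measurable_cst.
  apply/measurable_EFinP.
  have -> : EFin \o (fun t : R => fine (mu `]t, (t + h)%R[%classic)) = fubini_F mu F1.
    by apply/funext => t; rewrite /fubini_F int1; exact: fineK (mufin t).
  exact: (@measurable_fun_fubini_tonelli_F _ _ _ _ _ mu _ mF1 F10).
have k0 t : 0 <= k t by apply: divr_ge0; [apply: fine_ge0; exact: measure_ge0|exact: ltW].
have km (B : set X) : measurable B -> (\int[la]_(t in B) (k t)%:E <= m B)%E.
  move=> mB; apply: le_trans (Wm B mB).
  apply: ge0_le_integral_nonmeasurable => t; first by rewrite lee_fin.
  rewrite lee_fin ler_pM2r ?invr_gt0// -lee_fin (fineK (mufin t)) muE.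
  by apply: mass_itv; rewrite ltrDl.
have mEg : measurable_fun [set: R] (EFin \o g) by exact/measurable_EFinP.
have gE0 t : (0 <= (EFin \o g) t)%E by rewrite lee_fin.
have := integral_density_lower mk k0 km mEg gE0.
have -> // : (\int[la]_t ((EFin \o g) t * (k t)%:E) =
    (h^-1)%:E * \int[la]_t \int[mu]_x F (t, x))%E.
  rewrite -ge0_integralZl//; last 3 first.
  - exact: (@measurable_fun_fubini_tonelli_F _ _ _ _ _ mu _ mF F0).
  - by move=> t _; apply: integral_ge0 => x _; exact: F0.
  - by rewrite lee_fin invr_ge0 ltW.
  apply: eq_integral => t _; rewrite [(EFin \o g) t]/= /k EFinM (fineK (mufin t)).
  have -> : (\int[mu]_x F (t, x) = (g t)%:E * mu `]t, (t + h)%R[%classic)%E.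
    rewrite -integral_cst; last exact: measurable_itv.
    rewrite [RHS]integral_mkcond; apply: eq_integral => x _.
    rewrite /F /patch/= mem_setE in_itv/=.
    by case: ifP.
  by rewrite muleA muleC.
rewrite (@fubini_tonelli _ _ _ _ _ la mu F mF F0) => hle.
(* On ]x - h, x[ both g >= g(x) - e and g >= 0, so the average of g there is at least G(x). Moreover
   g <= G + e, and e integrates to at most e M. *)
pose G x := Num.max (g x - e) 0.
have mG : measurable_fun [set: R] (EFin \o G).
  apply/measurable_EFinP; apply: measurable_maxr; last exact: measurable_cst.
  by apply: measurable_funB => //; exact: measurable_cst.
have G0 x : (0 <= (EFin \o G) x)%E by rewrite lee_fin le_max lexx orbT.
have GF x : ((EFin \o G) x <= (h^-1)%:E * \int[la]_t F (t, x))%E.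
  rewrite lee_pdivlMl//.
  have -> : (h%:E * (EFin \o G) x = \int[la]_(t in `](x - h)%R, x[) (G x)%:E)%E.
    rewrite integral_cst//.
    have -> : (la `](x - h)%R, x[%classic = (x - (x - h))%:E)%E.
      apply: (etrans (@lebesgue_measure_itv R `](x - h)%R, x[)).
      by rewrite /= lte_fin ifT//; lra.
    by rewrite -!EFinM; congr EFin; ring.
  rewrite [leLHS]integral_mkcond; apply: ge0_le_integral_nonmeasurable => t.
    by rewrite /patch; case: ifP => // _; exact: G0.
  rewrite /patch; case: ifPn => [|_]; last exact: F0.
  rewrite inE/= in_itv/= => /andP[xt tx].
  rewrite /F/= tx (_ : x < t + h) ?andbT/=; last lra.
  rewrite lee_fin /G ge_max g0 andbT lerBlDr; apply: gu.
  by rewrite ler_norml; apply/andP; split; lra.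
apply: (@le_trans _ _ (\int[mu]_x ((EFin \o G) x + e%:E))%E).
  apply: ge0_le_integral => //.
  - by move=> x _; rewrite lee_fin.
  - by apply: emeasurable_funD => //; exact: measurable_cst.
  - move=> x _; rewrite -EFinD lee_fin.
    have : g x - e <= G x by rewrite le_max lexx.
    lra.
rewrite ge0_integralD//.
apply: leeD.
  apply: le_trans hle.
  rewrite -ge0_integralZl//; last 3 first.
  - exact: (@measurable_fun_fubini_tonelli_G _ _ _ _ _ la _ mF F0).
  - by move=> x _; apply: integral_ge0 => t _; exact: F0.
  - by rewrite lee_fin invr_ge0 ltW.
  apply: ge0_le_integral => //.
  apply: measurable_funeM.
  exact: (@measurable_fun_fubini_tonelli_G _ _ _ _ _ la _ mF F0).
have muT : (mu setT <= M%:E)%E by rewrite muE; exact: mass_fin.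
by rewrite integral_cst// EFinM lee_wpmul2l ?lee_fin.
Qed.

(** With G(x) = W(a, x), superadditivity gives h f(t) + G(t) <= G(t + h). Integrated over ]a, b -
    h[, the right side is the integral of G over ]a + h, b[, at most that over ]a, b - h[ plus h
    W(a, b); the finite integral of G then cancels. *)
Lemma quotient_integral_itv (f : R -> \bar R) (a b h : R) : 0 < h -> a < b ->
  measurable_fun [set: X] f -> (forall t, (0 <= f t)%E) ->
  (forall t, (f t <= (W t (t + h) / h)%:E)%E) ->
  (\int[la]_(t in `]a, (b - h)%R[) f t <= (W a b)%:E)%E.
Proof.
move=> h0 ab mf f0 fW.
have Wab : 0 <= W a b by rewrite (im_ge0 HW)// ltW.
have [abh|bha] := ltP a (b - h); last first.
  by rewrite set_itv_ge ?integral_set0 ?lee_fin// bnd_simp -leNgt.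
(* Clamping to [a, b] makes G monotone on the whole line, hence measurable. *)
pose c x := Num.max a (Num.min x b).
have c_mono x y : x <= y -> c x <= c y.
  by move=> xy; apply: le_max2 => //; exact: le_min2.
have cab x : a <= c x /\ c x <= b.
  by split; [rewrite le_max lexx|rewrite ge_max (ltW ab) ge_min lexx orbT].
have cid x : a <= x -> x <= b -> c x = x.
  by move=> ax xb; rewrite /c (min_idPl xb) (max_idPr ax).
pose G x := W a (c x).
have mG : measurable_fun [set: R] (EFin \o G).
  apply/measurable_EFinP; apply: nondecreasing_measurable => // x y xy.
  have [ax _] := cab x.
  by apply: (im_mono HW) => //; exact: c_mono.
have G0 x : (0 <= (EFin \o G) x)%E.
  by rewrite lee_fin (im_ge0 HW)//; have [] := cab x.
have Gle x : ((EFin \o G) x <= (W a b)%:E)%E.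
  have [ax xb] := cab x; rewrite lee_fin.
  exact: (im_mono HW (lexx a)).
have mI (x y : R) : measurable (`]x, y[%classic : set X) by exact: measurable_itv.
have step1 : (h%:E * \int[la]_(t in `]a, (b - h)%R[) f t +
     \int[la]_(t in `]a, (b - h)%R[) (EFin \o G) t <=
   \int[la]_(t in `](a + h)%R, b[) (EFin \o G) t)%E.
  rewrite -[in X in (_ <= X)%E](subrK h b) -ge0_integral_translate//.
  rewrite -ge0_integralZl//; last 2 first.
  - exact: measurable_funTS.
  - by rewrite lee_fin ltW.
  rewrite -ge0_integralD//; last 3 first.
  - by move=> t _; rewrite mule_ge0// lee_fin ltW.
  - by apply: measurable_funeM; exact: measurable_funTS.
  - exact: measurable_funTS.
  have mGh : measurable_fun [set: R] (fun t => (EFin \o G) (t + h)).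
    apply: (measurableT_comp mG); apply: measurable_funD => //; exact: measurable_cst.
  apply: ge0_le_integral => //.
  - by move=> t _; rewrite adde_ge0// mule_ge0// lee_fin ltW.
  - apply: emeasurable_funD; last exact: measurable_funTS.
    by apply: measurable_funeM; exact: measurable_funTS.
  - exact: measurable_funTS.
  move=> t; rewrite /= in_itv/= => /andP[at_ tb].
  have h1 : (h%:E * f t <= (W t (t + h))%:E)%E.
    apply: (@le_trans _ _ (h%:E * (W t (t + h) / h)%:E)%E).
      by apply: lee_wpmul2l; [rewrite lee_fin ltW|exact: fW].
    by rewrite -EFinM mulrC divfK// gt_eqF.
  apply: (@le_trans _ _ ((W t (t + h))%:E + (G t)%:E)%E); first exact: leeD2r.
  rewrite -EFinD lee_fin /G !cid; try lra.
  by rewrite addrC; apply: (im_super HW); lra.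
have lI (x y : R) b1 b2 : x < y ->
    (la [set` Interval (BSide b1 x) (BSide b2 y)] = (y - x)%:E)%E.
  by move=> xy; apply: (etrans (lebesgue_measure_itv _)); rewrite /= lte_fin ifT.
have mJ : measurable (`[(b - h), b[%classic : set X) by exact: measurable_itv.
have step2 : (\int[la]_(t in `](a + h)%R, b[) (EFin \o G) t <=
   h%:E * (W a b)%:E + \int[la]_(t in `]a, (b - h)%R[) (EFin \o G) t)%E.
  apply: (@le_trans _ _ (\int[la]_(t in `]a, b[) (EFin \o G) t)%E).
    apply: ge0_subset_integral => //; first exact: measurable_funTS.
    by move=> t; rewrite /= !in_itv/= => /andP[at_ ->]; rewrite andbT; lra.
  rewrite (@itv_bndbnd_setU _ _ (BRight a) (BLeft (b - h))) ?bnd_simp//; last lra.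
  rewrite ge0_integral_setU//; last 2 first.
  - exact: measurable_funTS.
  - rewrite disj_set2E; apply/eqP/seteqP; split => // t [/=].
    rewrite !in_itv/= => /andP[_ tb] /andP[bt _].
    by have := lt_le_trans tb bt; rewrite ltxx.
  rewrite addeC; apply: leeD => //.
  apply: (@le_trans _ _ (\int[la]_(t in `[(b - h)%R, b[) (W a b)%:E)%E).
    by apply: ge0_le_integral => //; exact: measurable_funTS.
  rewrite integral_cst// muleC lI; last lra.
  by rewrite opprB addrC subrK.
have Yfin : (\int[la]_(t in `]a, (b - h)%R[) (EFin \o G) t)%E \is a fin_num.
  rewrite ge0_fin_numE ?integral_ge0//.
  apply: (@le_lt_trans _ _ (\int[la]_(t in `]a, (b - h)%R[) (W a b)%:E)%E).
    by apply: ge0_le_integral => //; exact: measurable_funTS.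
  by rewrite integral_cst// lI// -EFinM ltry.
have := le_trans step1 step2; rewrite leeD2rE// -EFinM => h3.
by rewrite -(@lee_pmul2l _ h%:E) ?lte_fin// -EFinM.
Qed.
End difference_quotient_measures.

Section compactly_supported.
Variables (R : realType) (f : R -> R).
Hypothesis ccf : compactly_supported_continuous f.

Lemma compactly_supported_itv : exists2 N, 0 < N & forall t, N < `|t| -> f t = 0.
Proof.
have [_ /compact_bounded[N [_ hN]]] := ccf.
exists (`|N| + 1); first by rewrite ltr_pwDr.
move=> t Nt; apply/eqP; apply/negPn/negP => ft.
have : `|t| <= `|N| + 1.
  apply: hN; first by rewrite (le_lt_trans (ler_norm _))// ltrDl.
  exact: subset_closure.
by rewrite leNgt Nt.
Qed.

(** Compactness gives uniform continuity around [-(N+1), N+1]; if |t| > N + 1 and h < 1, then f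
    vanishes at both t and x. *)
Lemma compactly_supported_unif (e : R) : 0 < e -> \forall h \near 0^'+,
  forall t x, `|t - x| <= h -> `|f t - f x| <= e.
Proof.
move=> e0; have [N N0 fN] := compactly_supported_itv.
have [cf _] := ccf.
have /compact_near_coveringP cov := @segment_compact R (- (N + 1)) (N + 1).
have := cov _ (0^'+) (fun h t => forall x, `|t - x| <= h -> `|f t - f x| <= e) _.
have h1 : \forall h \near (0 : R)^'+, h < 1 by exact: nbhs_right_lt.
move=> /(_ _)hcov.
have {hcov} : \forall h \near 0^'+, `[- (N + 1), N + 1]%classic `<=`
    (fun t => forall x, `|t - x| <= h -> `|f t - f x| <= e).
  apply: hcov => t _.
  have e20 : 0 < e / 2 by rewrite divr_gt0.
  have /cvgrPdist_le/(_ _ e20) [d /= d0 hd] := cf t.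
  have d20 : 0 < d / 2 by rewrite divr_gt0.
  exists (ball t (d / 2), [set h | h < d / 2]).
    by split; [exact: nbhsx_ballx|exact: nbhs_right_lt].
  move=> [t' h] /= [tt' hd2] x t'x.
  have h2 : `|f t - f t'| <= e / 2.
    by apply: hd; apply: lt_le_trans tt' _; lra.
  have h3 : `|f t - f x| <= e / 2.
    apply: hd; rewrite /ball_/=.
    have := ler_distD t' t x; rewrite /ball/= in tt'; lra.
  have := ler_distD (f t) (f t') (f x); rewrite (distrC (f t') (f t)); lra.
apply: filterS2 h1 => h h1 hK t x tx.
have [tK|tK] := leP `|t| (N + 1).
  by apply: hK => //; rewrite /= in_itv/= -ler_norml.
have := ler_distD x t 0; rewrite !subr0 => h2.
rewrite !fN ?subr0 ?normr0 ?ltW//; lra.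
Qed.

Lemma compactly_supported_bounded : exists2 C, 0 < C & forall t, `|f t| <= C.
Proof.
have [N N0 fN] := compactly_supported_itv; have [cf _] := ccf.
have : compact (f @` `[- N, N]).
  apply: continuous_compact; last exact: segment_compact.
  exact: continuous_subspaceT.
move=> /compact_bounded[C [_ hC]]; exists (`|C| + 1); first by rewrite ltr_pwDr.
move=> t; have [tN|/fN ->] := leP `|t| N; last by rewrite normr0 addr_ge0.
apply: (hC (`|C| + 1)); first by rewrite (le_lt_trans (ler_norm _))// ltrDl.
by exists t => //; rewrite /= in_itv/= -ler_norml.
Qed.
End compactly_supported.

Section weak_limit.
Variables (R : realType) (W : R -> R -> R) (M : R) (HW : interval_mass W M).
Let X := measurableTypeR R.

(** For [W := extend T] this is convertible to [is_mu_h T]. *)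
Definition is_quotient_measure (h : R) (m : borel_measure R) :=
  forall B : set X, measurable B ->
    m B = (\int[lebesgue_measure]_(t in B) (W t (t + h) / h)%:E)%E.

Let mass_oo : (mass HW setT < +oo)%E.
Proof. by apply: le_lt_trans (mass_fin HW) _; rewrite ltry. Qed.

(** For h < 1 the measure is carried by [-1, 2]. By compactness the intervals ]a_k, b_k[ of an
    almost optimal cover still cover [-1, 2] when shortened to ]a_k, b_k - h[ with h small, and each
    of these has mass at most W(a_k, b_k). *)
Lemma quotient_measure_total (e : R) : 0 < e -> \forall h \near 0^'+,
  forall m, is_quotient_measure h m -> (m setT <= mass HW setT + e%:E)%E.
Proof.
move=> e0; have [p [plt pcov psum]] := mass_cover mass_oo e0.
have /compact_near_coveringP cov := @segment_compact R (-1) 2.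
have h1 : \forall h \near (0 : R)^'+, h < 1 by exact: nbhs_right_lt.
have h0 : \forall h \near (0 : R)^'+, 0 < h by exact: nbhs_right_gt.
have := cov _ (0^'+) (fun h t => exists k, (p k).1 < t /\ t < (p k).2 - h) _.
move=> /(_ _)hcov.
have {hcov} : \forall h \near 0^'+, `[-1, 2]%classic `<=`
    (fun t => exists k, (p k).1 < t /\ t < (p k).2 - h).
  apply: hcov => t _; have [k _] := pcov t I; rewrite /= in_itv/= => /andP[at_ tb].
  pose d := (p k).2 - t; have d0 : 0 < d / 2 by rewrite divr_gt0// subr_gt0.
  exists ([set t' | (p k).1 < t'] `&` [set t' | t' < t + d / 2], [set h | h < d / 2]).
    split; last exact: nbhs_right_lt.
    apply: filterI; first exact: lt_nbhsr.
    by apply: lt_nbhsl; rewrite ltrDl.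
  move=> [t' h] /= [[a b] hd]; exists k; split => //; rewrite /d in b hd; lra.
apply: filterS3 h0 h1 => h h0 h1 hK m hm.
have [f [mf f0 fW fE]] := quotient_minorant HW h0.
rewrite hm// fE//; pose nu := density_measure mf f0.
pose K : set X := `[-1, 2]%classic.
have mK : measurable K by exact: measurable_itv.
have nuK : nu (~` K) = 0%E.
  rewrite /nu density_measureE; apply: integral0_eq => t Kt.
  apply/eqP; rewrite eq_le f0 andbT; apply: le_trans (fW t) _.
  rewrite (im_supp HW) ?mul0r//; first by rewrite lerDl ltW.
  move: Kt; rewrite /K/= in_itv/= => /negP; rewrite negb_and -!ltNge.
  by case/orP => ?; [left|right]; lra.
have mI k : measurable (`](p k).1, ((p k).2 - h)[%classic : set X) by exact: measurable_itv.
apply: (@le_trans _ _ (nu K)).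
  have nuT : (nu setT = nu (~` K) + nu K)%E.
    by have := @measureDI _ _ _ nu setT K measurableT mK; rewrite setTD setTI.
  by rewrite nuK add0e in nuT; rewrite -nuT.
apply: le_trans psum.
apply: (@le_trans _ _ (\sum_(k <oo) nu `](p k).1, ((p k).2 - h)%R[%classic)%E).
  apply: measure_sigma_subadditive => // t /hK[k [a b]].
  by exists k => //; rewrite /= in_itv/= a.
apply: lee_nneseries => // k _.
exact: (quotient_integral_itv HW h0 (plt k) mf f0 fW).
Qed.

(* The lower bounds for f + C and C - f combine into a two-sided estimate thanks
   to the upper bound on the total mass. *)
Lemma quotient_measure_weak_limit (m : R -> borel_measure R) (f : R -> R) :
  (forall h, 0 < h -> is_quotient_measure h (m h)) ->
  compactly_supported_continuous f ->
  (\int[m h]_t (f t)%:E)%E @[h --> 0^'+] --> (\int[mass HW]_t (f t)%:E)%E.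
Proof.
move=> hm ccf; have [cf _] := ccf.
have [C C0 fC] := compactly_supported_bounded ccf.
have M0 : 0 <= M by apply: (le_trans (im_ge0 HW (lexx 0))); exact: (im_le HW (lexx 0)).
have mf : measurable_fun [set: R] f by exact: continuous_measurable_fun.
have ifin (nu : borel_measure R) : (nu setT < +oo)%E -> nu.-integrable setT (EFin \o f).
  move=> nuoo; apply: measurable_bounded_integrable => //.
  exists C; split; first exact: num_real.
  by move=> x Cx t _; exact: le_trans (fC t) (ltW Cx).
have icst (nu : borel_measure R) c : (nu setT < +oo)%E -> nu.-integrable setT (EFin \o cst c).
  move=> nuoo; apply: measurable_bounded_integrable => //.
  exact: bounded_cst.
have key e : 0 < e -> \forall h \near 0^'+, (\int[m h]_t (f t)%:E)%E \is a fin_num /\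
   `|fine (\int[mass HW]_t (f t)%:E)%E - fine (\int[m h]_t (f t)%:E)%E| <= e.
  (* [e1] bounds the oscillation of f at scale h, at a cost of e1 M; [e2] bounds the excess of total
     mass, at a cost of C e2. Each cost is at most e / 2. *)
  move=> e0; pose e1 := e / (2 * (M + 1)); pose e2 := e / (2 * (C + 1)).
  have e10 : 0 < e1 by rewrite divr_gt0// mulr_gt0//; lra.
  have e20 : 0 < e2 by rewrite divr_gt0// mulr_gt0//; lra.
  have e1M : e1 * M <= e / 2.
    have : e1 * (2 * (M + 1)) = e by rewrite divfK// gt_eqF// mulr_gt0//; lra.
    nra.
  have e2C : C * e2 <= e / 2.
    have : e2 * (2 * (C + 1)) = e by rewrite divfK// gt_eqF// mulr_gt0//; lra.
    nra.
  clearbody e1 e2.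
  have h0 : \forall h \near (0 : R)^'+, 0 < h by exact: nbhs_right_gt.
  apply: filterS3 h0 (compactly_supported_unif ccf e10) (quotient_measure_total e20).
  move=> h h0 fu /(_ _ (hm h h0)) mT.
  have moo : (m h setT < +oo)%E by apply: (le_lt_trans mT); rewrite lte_add_pinfty ?ltry.
  have if1 := ifin _ moo; have if2 := ifin _ mass_oo.
  have x1 := integrable_fin_num measurableT if1.
  have x2 := integrable_fin_num measurableT if2.
  have Wm (B : set X) : measurable B ->
      (\int[lebesgue_measure]_(t in B) (W t (t + h) / h)%:E <= m h B)%E.
    by move=> mB; rewrite (hm h h0).
  have L1 := @integral_mass_le _ _ _ HW (m h) h e1 (fun t => f t + C) h0 (ltW e10) Wm.
  have L2 := @integral_mass_le _ _ _ HW (m h) h e1 (fun t => C - f t) h0 (ltW e10) Wm.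
  have intp (nu : borel_measure R) : (nu setT < +oo)%E ->
     (\int[nu]_t (f t + C)%:E = \int[nu]_t (f t)%:E + C%:E * nu setT)%E.
    move=> nuoo; rewrite -integral_cst//.
    exact: (@integralD _ _ _ nu setT measurableT _ _ (ifin _ nuoo) (icst _ C nuoo)).
  have intn (nu : borel_measure R) : (nu setT < +oo)%E ->
     (\int[nu]_t (C - f t)%:E = C%:E * nu setT - \int[nu]_t (f t)%:E)%E.
    move=> nuoo; rewrite -integral_cst//.
    exact: (@integralB _ _ _ nu setT measurableT _ _ (icst _ C nuoo) (ifin _ nuoo)).
  split; first exact: x1.
  move: L1 L2; rewrite !intp// !intn//.
  have a1 : m h setT \is a fin_num by rewrite ge0_fin_numE.
  have a2 : mass HW setT \is a fin_num by rewrite ge0_fin_numE.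
  move: mT; rewrite -(fineK x1) -(fineK x2) -(fineK a1) -(fineK a2).
  move: (fine (\int[m h]_t _)%E) (fine (\int[mass HW]_t _)%E) => x y.
  move: (fine (m h setT)) (fine (mass HW setT)) => a b.
  rewrite -!EFinM -!EFinD !lee_fin => ab L1 L2.
  have mfC : measurable_fun [set: R] (fun t => f t + C).
    by apply: measurable_funD => //; exact: measurable_cst.
  have mCf : measurable_fun [set: R] (fun t => C - f t).
    by apply: measurable_funB => //; exact: measurable_cst.
  have {}L1 : y + C * b <= x + C * a + e1 * M.
    apply: L1 => //.
      by move=> t; have := fC t; rewrite ler_norml => /andP[? ?]; lra.
    by move=> t z /fu; rewrite ler_norml => /andP[? ?]; lra.
  have {}L2 : C * b - y <= C * a - x + e1 * M.
    apply: L2 => //.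
      by move=> t; have := fC t; rewrite ler_norml => /andP[? ?]; lra.
    by move=> t z /fu; rewrite ler_norml => /andP[? ?]; lra.
  have Cab : C * a <= C * b + C * e2 by rewrite -mulrDr ler_pM2l.
  by rewrite /= ler_norml; apply/andP; split; lra.
have y1 := integrable_fin_num measurableT (ifin _ mass_oo).
rewrite -(fineK y1); apply/fine_cvgP; split.
  by apply: filterS (key 1 ltr01) => h [].
by apply/cvgrPdist_le => e e0; apply: filterS (key e e0) => h [].
Qed.
End weak_limit.

(** * Partitions of [0, 1] and the theorem *)

Lemma clamp01_id (R : realType) (x : R) : 0 <= x <= 1 -> clamp01 x = x.
Proof. by move=> /andP[x0 x1]; rewrite /clamp01 (max_idPl x0) (min_idPl x1). Qed.

Section partitions.
Variable R : realType.
Implicit Type P : seq R.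

Lemma itv_partition_pt P i : itv_partition 0 1 P -> (i <= size P)%N -> 0 <= pt P i <= 1.
Proof.
move=> [pP /eqP lP] iP; have iin : pt P i \in 0 :: P by apply: mem_nth.
apply/andP; split; last by rewrite -lP; exact: path_lt_le_last.
move: iin; rewrite in_cons => /predU1P[->//|]; move: (pt P i) => x.
by move/(order_path_min lt_trans) : pP => /allP h /h /ltW.
Qed.

Lemma A_psum (T : R -> R -> R) q P : itv_partition 0 1 P ->
  A_ T q P = psum (block_utility (extend T) q) 0 P.
Proof.
move=> PP; rewrite /A_ /psum; apply: eq_bigr => i _.
rewrite /block_utility -!/(pt P _).
by rewrite /extend !clamp01_id// itv_partition_pt// ltnW.
Qed.

(** The points i/(n+1) for 1 <= i <= n + 1, giving partitions of vanishing mesh along which the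
    infimum in (iii) is approached. *)
Definition uniform_partition (n : nat) : seq R :=
  [seq i.+1%:R / n.+1%:R | i <- iota 0 n.+1].

Let pt_uniform n i : (i <= n.+1)%N -> pt (uniform_partition n) i = i%:R / n.+1%:R.
Proof.
case: i => [|i] ni; first by rewrite /pt mul0r.
by rewrite /pt/= (nth_map 0%N) ?size_iota// nth_iota.
Qed.

Let size_uniform n : size (uniform_partition n) = n.+1.
Proof. by rewrite size_map size_iota. Qed.

Lemma uniform_partitionP n : itv_partition 0 1 (uniform_partition n).
Proof.
split.
  apply/(pathP 0) => i; rewrite size_uniform => ni.
  have ilt : pt (uniform_partition n) i < pt (uniform_partition n) i.+1.
    by rewrite !pt_uniform// 1?ltnW// ltr_pM2r ?invr_gt0// ltr_nat.
  exact: ilt.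
have last_pt : last 0 (uniform_partition n) = pt (uniform_partition n) n.+1.
  by rewrite -[n.+1](size_uniform n) /pt nth_last.
rewrite last_pt pt_uniform// divff//.
Qed.

Lemma mesh_uniform n : mesh (uniform_partition n) <= n.+1%:R^-1.
Proof.
apply/bigmax_leP; split => [|i _]; first by rewrite invr_ge0.
have ni : (i < n.+1)%N by rewrite -[n.+1](size_uniform n).
rewrite (pt_uniform ni) (pt_uniform (ltnW ni)) -mulrBl -natrB// subSnn mul1r.
by rewrite gtr0_norm// invr_gt0.
Qed.

Lemma mesh_ge0 P : 0 <= mesh P.
Proof. exact: bigmax_ge_id. Qed.

Lemma mesh_ge P (i : 'I_(size P)) : pt P i.+1 - pt P i <= mesh P.
Proof. by apply: le_trans (ler_norm _) _; rewrite /mesh; exact: le_bigmax. Qed.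

End partitions.

Theorem theorem2p23 (R : realType) (T : R -> R -> R)
  (T_ge0 : forall s t : R, 0 <= s -> s <= t -> t <= 1 -> 0 <= T s t)
  (T_triangle : forall r s t : R, 0 <= r -> r <= s -> s <= t -> t <= 1 ->
     T r s <= T r t - T s t) :
  exists mu : borel_measure R,
  (* (i) *)
  (maximal_admissible T mu /\
   forall mu' : borel_measure R, maximal_admissible T mu' ->
     forall B : set (measurableTypeR R), measurable B -> mu' B = mu B) /\
  (* (ii), weak limit *)
  (exists mu_ : R -> borel_measure R,
     (forall h : R, 0 < h -> is_mu_h T h (mu_ h)) /\
     forall f : R -> R, compactly_supported_continuous f ->
       (\int[mu_ h]_t (f t)%:E)%E @[h --> 0^'+]
         --> (\int[mu]_t (f t)%:E)%E) /\
  (exists (rho : R -> R) (mus : borel_measure R),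
     lebesgue_decomposition mu rho mus) /\
  forall (rho : R -> R) (mus : borel_measure R),
    lebesgue_decomposition mu rho mus ->
    (* (ii), density *)
    {ae @lebesgue_measure R, forall t : R,
       forall r s : nat -> R,
         (forall n, 0 <= r n <= 1) -> (forall n, 0 <= s n <= 1) ->
         {homo r : m n / (m <= n)%N >-> m <= n} -> r n @[n --> \oo] --> t ->
         {homo s : m n / (m <= n)%N >-> n <= m} -> s n @[n --> \oo] --> t ->
         (forall n, r n < s n) ->
         T (r n) (s n) / (s n - r n) @[n --> \oo] --> rho t} /\
    forall q : R, q != 0 -> q < 1 ->
      (* (iii) *)
      (forall P Q : seq R, itv_partition 0 1 P -> itv_partition 0 1 Q ->
         {subset Q <= P} -> (A_ T q P <= A_ T q Q)%E) /\
      (\int[lebesgue_measure]_(t in `[0%R : R, 1%R : R]) u_ q (rho t))%E =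
        ereal_inf [set A_ T q P | P in [set P | itv_partition 0 1 P]] /\
      (* (iv) *)
      (forall P : nat -> seq R, (forall k, itv_partition 0 1 (P k)) ->
         mesh (P k) @[k --> \oo] --> 0 ->
         A_ T q (P k) @[k --> \oo]
           --> (\int[lebesgue_measure]_(t in `[0%R : R, 1%R : R]) u_ q (rho t))%E).
Proof.
have HW := extend_interval_mass T_ge0 T_triangle.
have mass_oo : (mass HW setT < +oo)%E.
  by apply: le_lt_trans (mass_fin HW) _; rewrite ltry.
have mass_max : maximal_admissible T (mass HW).
  by split; [move=> a b ab; exact: mass_itv|exact: mass_maximal].
exists (mass HW); split.
  split => // mu' [adm' max'] B mB; apply/eqP; rewrite eq_le.
  by apply/andP; split; [apply: mass_max.2|apply: max' => //; exact: mass_max.1].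
split.
  have /choice[mu_ hmu] : forall h : R, exists m : borel_measure R,
      0 < h -> is_quotient_measure (extend T) h m.
    (* For h <= 0 the measure chosen is an arbitrary default. *)
    move=> h; have [h0|h0] := ltP 0 h; last by exists (mass HW).
    have [f [mf f0 fW fE]] := quotient_minorant HW h0.
    by exists (density_measure mf f0) => _ B mB; rewrite fE.
  exists mu_; split; first exact: hmu.
  by move=> f; exact: quotient_measure_weak_limit.
split; first exact: lebesgue_decomposition_exists.
move=> rho mus dec; split.
  have FF := ae_filter_ringOfSetsType (@lebesgue_measure R).
  apply: (@filterS _ _ FF _ _ _ (density_limit dec)) => t Ht r s r01 s01 rnd rt snd st rs.
  apply/cvgrPdist_le => e e0; have [d d0 hd] := Ht e e0.
  have /cvgrPdist_lt/(_ _ d0) rd := rt.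
  have /cvgrPdist_lt/(_ _ d0) sd := st.
  apply: filterS2 rd sd => n; rewrite !ltr_norml => /andP[_ h1] /andP[h2 _].
  (* Monotone convergence of the endpoints puts t in [r_n, s_n], as [density_limit] requires. *)
  have rlt : r n <= t.
    by rewrite -(cvg_lim _ rt)//; apply: nondecreasing_cvgn_le => //; apply/cvg_ex; exists t.
  have slt : t <= s n.
    by rewrite -(cvg_lim _ st)//; apply: nonincreasing_cvgn_ge => //; apply/cvg_ex; exists t.
  have := hd (r n) (s n) (rs n); rewrite rlt slt => /(_ isT).
  rewrite /extend !clamp01_id// => hh.
  have sr0 : 0 < s n - r n by rewrite subr_gt0.
  have -> : rho t - T (r n) (s n) / (s n - r n) =
      - ((T (r n) (s n) - rho t * (s n - r n)) / (s n - r n)).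
    by rewrite mulrBl mulfK ?gt_eqF// opprB.
  rewrite normrN normrM normfV (gtr0_norm sr0) ler_pdivrMr//.
  by apply: hh; lra.
move=> q q0 q1.
have block_super := block_utility_super HW q0 q1.
have int01 : (\int[lebesgue_measure]_(t in `[0%R : R, 1%R : R]) u_ q (rho t) =
    \int[lebesgue_measure]_(t in `]0%R : R, 1%R : R]) u_ q (rho t))%E.
  rewrite integral_itv_obnd_cbnd//; apply: measurable_funTS.
  by apply: (measurableT_comp (measurable_u q)); case: dec.
have part_iv (P : nat -> seq R) : (forall k, itv_partition 0 1 (P k)) ->
    mesh (P k) @[k --> \oo] --> 0 -> A_ T q (P k) @[k --> \oo]
      --> (\int[lebesgue_measure]_(t in `[0%R : R, 1%R : R]) u_ q (rho t))%E.
  move=> hP mP; rewrite int01.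
  have -> : (fun k => A_ T q (P k)) =
      (fun k => psum (block_utility (extend T) q) 0 (P k)).
    by apply/funext => k; rewrite A_psum.
  apply: (psum_utility_cvg q0 q1 dec) => [k|k|e e0].
  - by have [] := hP k.
  - by have [_ /eqP] := hP k.
  have /cvgrPdist_le/(_ e e0) := mP; apply: filterS => k.
  rewrite sub0r normrN => /(le_trans (ler_norm _)) mk i.
  by apply: le_trans mk; exact: mesh_ge.
split.
  move=> P Q hP hQ QP; rewrite !A_psum//.
  have [pP /eqP lP] := hP; have [pQ /eqP lQ] := hQ.
  by apply: psum_refine => //; rewrite lP.
split; last exact: part_iv.
apply/eqP; rewrite eq_le; apply/andP; split.
  apply: le_ereal_inf_tmp => _ [P hP <-]; rewrite A_psum// int01.
  have [pP /eqP lP] := hP.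
  by have := integral_u_le_psum q0 q1 dec pP; rewrite lP.
(* The infimum lies below every term of a sequence that, by (iv), tends to the integral. *)
have hU : A_ T q (uniform_partition R k) @[k --> \oo]
    --> (\int[lebesgue_measure]_(t in `[0%R : R, 1%R : R]) u_ q (rho t))%E.
  apply: part_iv; first exact: uniform_partitionP.
  apply: (@squeeze_cvgr _ _ _ _ (fun=> 0) (fun n => n.+1%:R^-1)).
  - by apply: nearW => n; rewrite mesh_uniform andbT; exact: mesh_ge0.
  - exact: cvg_cst.
  - exact: cvg_harmonic.
rewrite -(cvg_lim _ hU)//; apply: lime_ge; first by apply/cvg_ex; eexists; exact: hU.
by apply: nearW => n; apply: ereal_inf_lbound; exists (uniform_partition R n) => //; exact: uniform_partitionP.
Qed.
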